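(* Let $\tilde N(t)$ and $\bar N(t)$ be the counting processes of a time-stationary slow MMPP$_p$ and its associated (time-stationary) MTCP$_{2p}$, respectively. Then these processes have the same first and second moments. That is, for all $p\ge 2$ and all $t\ge 0$, $$\mathbb{E}[\tilde N^k(t)]=\mathbb{E}[\bar N^k(t)],\qquad \text{for } k=1,2.$$ Further, $\tilde N(t)$ and $\bar N(t)$ have different third moments.
   Context: **MAP.** A Markovian arrival process of order $m$ (MAP$_m$) with parameters $(\boldsymbol\eta,C,D)$ is a two-dimensional continuous-time Markov process $\{(N(t),X(t)):t\ge 0\}$ on $\{0,1,2,\dots\}\times\{1,\dots,m\}$ with $N(0)=0$ and $X(0)\sim\boldsymbol\eta$. Here $D$ is an $m\times m$ matrix with non-negative entries, and $C$ is an $m\times m$ matrix with negative diagonal and non-negative off-diagonal entries. The sum $Q=C+D$ is an irreducible generator (zero row sums), the generator of the phase process $X$. From state $(n,i)$ the process jumps to $(n,j)$, $j\neq i$, at rate $C_{ij}$ and to $(n+1,j)$ (including $j=i$) at rate $D_{ij}$. $N(t)$ is the counting process. The MAP is time-stationary if $\boldsymbol\eta=\boldsymbol\pi$, where $\boldsymbol\pi$ is the unique stationary distribution of $Q$ ($\boldsymbol\pi Q=\mathbf 0'$, $\boldsymbol\pi\mathbf 1=1$). **Slow MMPP.** A Markov modulated Poisson process (MMPP$_p$) with irreducible phase generator $G$ and event rates $\lambda_1,\dots,\lambda_p$ is the MAP$_p$ with $D=\mathrm{diag}(\lambda_1,\dots,\lambda_p)$ and $C=G-D$. Write $q_{ij}=G_{ij}$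 for $i\ne j$ and $S_i=\sum_{j\ne i}q_{ij}$, so that $G_{ii}=-S_i$. The MMPP is slow if $\lambda_i>S_i$ for every $i=1,\dots,p$. **Associated MTCP.** A Markovian transition counting process (MTCP) is a MAP with $C$ diagonal and $D$ having zero diagonal, i.e. it counts all transitions of the phase process. The MTCP$_{2p}$ associated with a slow MMPP$_p$ has phase generator $\bar Q$ consisting of $p\times p$ blocks of size $2\times 2$. The $i$-th diagonal block is $$\begin{pmatrix}-\lambda_i&\lambda_i-S_i\\ \lambda_i-S_i&-\lambda_i\end{pmatrix},$$ and the $(i,j)$ block for $i\ne j$ is $q_{ij}I_2$, where $I_2$ is the $2\times 2$ identity matrix. Its event matrix is $\bar D=\bar Q-\mathrm{diag}(\bar Q)$ and $\bar C=\mathrm{diag}(\bar Q)$, where $\mathrm{diag}(\bar Q)$ is the diagonal matrix with the same diagonal as $\bar Q$.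
   Formalization: The third-moment claim assumes the event rates are not all equal (if they are, both processes are Poisson with the same rate and all moments agree); it is then proved that the third moments differ for every t > 0 outside a finite set. *)

(* Defs.v *)
From HB Require Import structures.
From mathcomp Require Import all_boot all_order all_algebra.
From mathcomp Require Import all_classical all_reals all_analysis.

Set Implicit Arguments.
Unset Strict Implicit.
Unset Printing Implicit Defensive.

Import Order.TTheory GRing.Theory Num.Theory.
Import numFieldNormedType.Exports.

Local Open Scope classical_set_scope.
Local Open Scope ring_scope.

Section ContinuousTimeMarkovChains.
Context {R : realType}.

(* Only times t >= 0 are constrained; [p t x y] is the probability of being
   in y at time t when starting from x. *)
Definition transition_function (S : countType) (p : R -> S -> S -> R) : Prop :=
  [/\ forall t x y, 0 <= t -> 0 <= p t x y,
      forall t x, 0 <= t -> (\esum_(y in [set: S]) (p t x y)%:E = 1)%E,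
      forall x y, p 0 x y = (x == y)%:R
    & forall s t x z, 0 <= s -> 0 <= t ->
        (p (s + t) x z)%:E = (\esum_(y in [set: S]) (p s x y * p t y z)%:E)%E].

(* [q] is the full Q-matrix: q x y is the jump rate from x to y for x != y,
   and q x x is minus the total rate out of x. *)
Definition has_rates (S : countType) (p : R -> S -> S -> R)
    (q : S -> S -> R) : Prop :=
  forall x y, (p h x y - (x == y)%:R) / h @[h --> 0^'+] --> q x y.

(* Right-continuous time-homogeneous Markov chain on a countable state space. *)
Definition markov_chain d (T : measurableType d) (P : probability T R)
    (S : countType) (q : S -> S -> R) (Z : R -> T -> S) : Prop :=
  [/\ forall t x, 0 <= t -> measurable [set w | Z t w = x],
      forall w t, 0 <= t -> \forall s \near t^'+, Z s w = Z t w
    & exists p : R -> S -> S -> R,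
        [/\ transition_function p,
            has_rates p q
          & forall (n : nat) (t : nat -> R) (z : nat -> S),
              0 <= t 0%N -> (forall k, (k <= n)%N -> t k <= t k.+1) ->
              P [set w | forall k, (k <= n.+1)%N -> Z (t k) w = z k] =
              (P [set w | forall k, (k <= n)%N -> Z (t k) w = z k] *
               (p (t n.+1 - t n) (z n) (z n.+1))%:E)%E]].

End ContinuousTimeMarkovChains.

Section MarkovianArrivalProcesses.
Context {R : realType}.

Definition generator m (Q : 'M[R]_m) : Prop :=
  (forall i j, i != j -> 0 <= Q i j) /\ (forall i, \sum_j Q i j = 0).

Definition irreducible m (Q : 'M[R]_m) : Prop :=
  forall i j, connect (fun k l : 'I_m => (k != l) && (0 < Q k l)) i j.

Definition stationary_distribution m (Q : 'M[R]_m) (pi : 'rV[R]_m) : Prop :=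
  [/\ forall i, 0 <= pi 0 i, \sum_i pi 0 i = 1 & pi *m Q = 0].

Definition MAP_parameters m (C D : 'M[R]_m) : Prop :=
  [/\ forall i j, 0 <= D i j,
      forall i, C i i < 0,
      forall i j, i != j -> 0 <= C i j,
      generator (C + D)
    & irreducible (C + D)].

(* Since C + D has zero row sums, the diagonal entry C i i is minus the total
   rate out of (n, i), as required of a Q-matrix. *)
Definition MAP_rates m (C D : 'M[R]_m) (x y : nat * 'I_m) : R :=
  if y.1 == x.1 then C x.2 y.2
  else if y.1 == x.1.+1 then D x.2 y.2
  else 0.

Definition MAP d (T : measurableType d) (P : probability T R) m
    (eta : 'rV[R]_m) (C D : 'M[R]_m)
    (N : R -> T -> nat) (X : R -> T -> 'I_m) : Prop :=
  [/\ MAP_parameters C D,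
      forall w, N 0 w = 0%N,
      forall i, P [set w | X 0 w = i] = (eta 0 i)%:E
    & markov_chain P (MAP_rates C D) (fun t w => (N t w, X t w))].

Definition time_stationary_MAP d (T : measurableType d) (P : probability T R) m
    (C D : 'M[R]_m) (N : R -> T -> nat) (X : R -> T -> 'I_m) : Prop :=
  exists2 pi : 'rV[R]_m,
    stationary_distribution (C + D) pi & MAP P pi C D N X.

Definition MMPP_D p (lam : 'rV[R]_p) : 'M[R]_p := diag_mx lam.

Definition MMPP_C p (G : 'M[R]_p) (lam : 'rV[R]_p) : 'M[R]_p :=
  G - MMPP_D lam.

Definition exit_rate p (G : 'M[R]_p) (i : 'I_p) : R :=
  \sum_(j | j != i) G i j.

Definition slow p (G : 'M[R]_p) (lam : 'rV[R]_p) : Prop :=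
  forall i, exit_rate G i < lam 0 i.

Definition diag_part m (A : 'M[R]_m) : 'M[R]_m := diag_mx (\row_i A i i).

(* The order 2p appears as the sum of p block sizes equal to 2. *)
Definition MTCP_Q p (G : 'M[R]_p) (lam : 'rV[R]_p) :
    'M[R]_(\sum_(i < p) 2) :=
  \mxblock_(i < p, j < p)
    (if i == j then
       \matrix_(a < 2, b < 2)
         (if a == b then - lam 0 i else lam 0 i - exit_rate G i)
     else (G i j)%:M).

Definition MTCP_C p (G : 'M[R]_p) (lam : 'rV[R]_p) := diag_part (MTCP_Q G lam).

Definition MTCP_D p (G : 'M[R]_p) (lam : 'rV[R]_p) :=
  MTCP_Q G lam - diag_part (MTCP_Q G lam).

Definition moment d (T : measurableType d) (P : probability T R)
    (N : R -> T -> nat) (k : nat) (t : R) : \bar R :=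
  ('E_P[(fun w => (N t w)%:R ^+ k)%R])%E.

End MarkovianArrivalProcesses.

(* Main.v *)
Require Import Defs.
From HB Require Import structures.
From mathcomp Require Import all_boot all_order all_algebra.
From mathcomp Require Import all_classical all_reals all_analysis.
From mathcomp Require Import measurable_realfun.
From mathcomp Require Import zify ring lra.

Set Implicit Arguments.
Unset Strict Implicit.
Unset Printing Implicit Defensive.

Import Order.TTheory GRing.Theory Num.Theory.
Import numFieldNormedType.Exports.

Local Open Scope classical_set_scope.
Local Open Scope ring_scope.

(** The law of the number of events is governed by a triangular system of linear
    equations for the row vectors [A n t] of probabilities of being in level n
    and each phase; multiplied by binomial coefficients and summed over n, it
    becomes b_k' = b_k Q + b_(k-1) D for the vectors b_k of binomial moments.
    Adding the two phases of each block turns the MTCP into a p-phase system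
    with the generator G of the MMPP and event matrix G + Lam instead of Lam.
    Since pi G = 0 and G 1 = 0, this replacement is invisible in b_1 and in the
    total mass of b_2.  The totals of b_3 differ by a function d with d(0) = 0,
    d'(0) = 0 and d''(t) = t g'(t), where g(t) = pi Lam exp(tG) Lam 1.
    It is analytic and, for nonconstant rates, not identically zero, as
    g'(0) = pi Lam G Lam 1 is minus half a positive Dirichlet form; and d' has a
    negative limit at infinity because the centred g decays exponentially.
    Hence d has only finitely many zeros. *)

(** * Scalar calculus and exponential generating functions *)

(** Nothing is known about the moments in advance: the levels are unbounded and the forward
    equations hold level by level, so the sum over n cannot be differentiated termwise. Every moment
    is therefore truncated at a level M. The truncated vectors solve the same linear equations up to
    the flow across level M, which tends to 0 uniformly on [0, T] because the next binomial moment
    is bounded independently of M. A Gronwall estimate turns a vanishing forcing term into a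
    vanishing solution, so it suffices to exhibit explicit solutions of the limit equations, built
    from the antiderivatives of exp(tG); from k = 2 on, only the difference of the two processes is
    solved for. The forward equations themselves have to be derived from the rates at time 0. This
    works because the total rates are bounded uniformly in the level and only two levels lead into a
    given state. Nonconstant rates are essential for the third moment: for constant rates g is
    constant, so d vanishes identically. *)

Definition derives {R : realType} (f : R -> R) (t d : R) := is_derive t (1 : R) f d.

Lemma derives_eq {R : realType} (f g : R -> R) (t d e : R) :
  derives f t d -> f =1 g -> d = e -> derives g t e.
Proof. by move=> + /funext <- <-. Qed.

Lemma derives_cst {R : realType} (a t : R) : derives (fun=> a) t 0.
Proof. exact: is_derive_cst. Qed.

Lemma derives_id {R : realType} (t : R) : derives id t 1.
Proof. exact: is_derive_id. Qed.

Lemma derivesD {R : realType} (f g : R -> R) (t a b : R) :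
  derives f t a -> derives g t b -> derives (fun s => f s + g s) t (a + b).
Proof. by move=> fa gb; exact: is_deriveD. Qed.

Lemma derivesB {R : realType} (f g : R -> R) (t a b : R) :
  derives f t a -> derives g t b -> derives (fun s => f s - g s) t (a - b).
Proof. by move=> fa gb; exact: is_deriveB. Qed.

Lemma derivesM {R : realType} (f g : R -> R) (t a b : R) :
  derives f t a -> derives g t b ->
  derives (fun s => f s * g s) t (a * g t + f t * b).
Proof.
move=> fa gb; apply: derives_eq; first exact: (is_deriveM fa gb).
  by [].
by rewrite /= /GRing.scale /= addrC mulrC.
Qed.

Lemma derivesMl {R : realType} (c : R) (f : R -> R) (t a : R) :
  derives f t a -> derives (fun s => c * f s) t (c * a).
Proof.
move=> fa; apply: derives_eq; first exact: (derivesM (derives_cst c t) fa).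
  by [].
by rewrite mul0r add0r.
Qed.

Lemma derives_sum {R : realType} (I : Type) (r : seq I) (P : pred I)
    (f : I -> R -> R) (t : R) (a : I -> R) :
  (forall i, P i -> derives (f i) t (a i)) ->
  derives (fun s => \sum_(i <- r | P i) f i s) t (\sum_(i <- r | P i) a i).
Proof.
move=> fa; elim: r => [|x r IH].
  apply: (derives_eq (derives_cst 0 t)); last by rewrite big_nil.
  by move=> s; rewrite big_nil.
case: (boolP (P x)) => Px.
  apply: (derives_eq (derivesD (fa x Px) IH)); last by rewrite big_cons Px.
  by move=> s; rewrite big_cons Px.
apply: (derives_eq IH); last by rewrite big_cons (negbTE Px).
by move=> s; rewrite big_cons (negbTE Px).
Qed.

Lemma derives_compN {R : realType} (f : R -> R) (t a : R) :
  derives f (- t) a -> derives (fun s => f (- s)) t (- a).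
Proof.
move=> fa.
have gN : is_derive t (1 : R) (fun s : R => - s) (- 1).
  exact: (is_deriveN (derives_id t)).
apply: derives_eq; first exact: (@is_derive1_comp R f (fun s => - s) t a (-1) fa gN).
  by [].
by rewrite mulrN1.
Qed.

Lemma derives_continuous {R : realType} (f : R -> R) (t a : R) :
  derives f t a -> {for t, continuous f}.
Proof.
by move=> fa; apply: differentiable_continuous; apply/derivable1_diffP; case: fa.
Qed.

Lemma eq_of_derives {R : realType} (f g d : R -> R) :
  (forall t, derives f t (d t)) -> (forall t, derives g t (d t)) ->
  f 0 = g 0 -> f =1 g.
Proof.
move=> fd gd fg0 t; apply/eqP; rewrite -subr_eq0.
have h0 s : is_derive s (1 : R) (fun s => f s - g s) 0.
  by apply: (derives_eq (derivesB (fd s) (gd s))) => //; rewrite subrr.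
by rewrite (is_derive_0_is_cst t 0 h0) fg0 subrr.
Qed.

Lemma nonincr_of_derives {R : realType} (f d : R -> R) (a b : R) : a <= b ->
  (forall t, a < t < b -> derives f t (d t)) ->
  (forall t, a < t < b -> d t <= 0) ->
  {within `[a, b], continuous f} -> f b <= f a.
Proof.
rewrite le_eqVlt => /predU1P[-> //|ab] fd d0 cf; rewrite -subr_le0.
have [|c + ->] := MVT ab _ cf (df := d).
  by move=> x /[!in_itv]/= /fd.
by rewrite in_itv /= => /d0 dc; rewrite pmulr_lle0 ?subr_gt0.
Qed.

Definition geometric_growth {R : realType} (c : nat -> R) :=
  exists B K : R, forall n, `|c n| <= B * K ^+ n.

Definition egf {R : realType} (c : nat -> R) (t : R) : R :=
  limn (pseries (fun n => c n / n`!%:R) t).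

Lemma cvg_egf {R : realType} (c : nat -> R) (t : R) : geometric_growth c ->
  cvgn (pseries (fun n => c n / n`!%:R) t).
Proof.
move=> [B [K cBK]]; apply: normed_cvg.
have B0 : 0 <= B by have := cBK 0%N; rewrite expr0 mulr1; apply: le_trans.
apply: (@series_le_cvg _ _ (fun n => B * exp_coeff (`|K| * `|t|) n)).
- by move=> n /=; rewrite normr_ge0.
- by move=> n; rewrite mulr_ge0 // /exp_coeff /= divr_ge0 // exprn_ge0 // mulr_ge0.
- move=> n /=; rewrite /exp_coeff /= !normrM normrX normfV normr_nat exprMn.
  rewrite mulrAC !mulrA ler_wpM2r ?invr_ge0 // ler_wpM2r ?exprn_ge0 //.
  by rewrite (le_trans (cBK n)) // ler_wpM2l // -normrX ler_norm.
have -> : series (fun n => B * exp_coeff (`|K| * `|t|) n) =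
    (fun n => B * series (exp_coeff (`|K| * `|t|)) n).
  by apply/funext => n; rewrite /series /= mulr_sumr.
apply/cvg_ex; exists (B * expR (`|K| * `|t|)).
by apply: cvgMr; exact: is_cvg_series_exp_coeff.
Qed.

Lemma geometric_growthS {R : realType} (c : nat -> R) :
  geometric_growth c -> geometric_growth (fun n => c n.+1).
Proof.
by move=> [B [K cBK]]; exists (B * K), K => n; rewrite -mulrA -exprS.
Qed.

Lemma geometric_growth_cons {R : realType} (x : R) (c : nat -> R) :
  geometric_growth c ->
  geometric_growth (fun n => if n is m.+1 then c m else x).
Proof.
move=> [B [K cBK]]; exists (`|x| + `|B|), (`|K| + 1).
have K1 : 1 <= `|K| + 1 by rewrite lerDr.
case=> [|n]; first by rewrite expr0 mulr1 lerDl.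
rewrite (le_trans (cBK n)) // (le_trans (ler_norm _)) // normrM normrX.
apply: ler_pM; rewrite ?exprn_ge0 ?lerDr //.
rewrite (@le_trans _ _ ((`|K| + 1) ^+ n)) //; last exact: ler_weXn2l.
by rewrite lerXn2r ?nnegrE ?lerDl // addr_ge0.
Qed.

(** With coefficients [c n / n!], termwise differentiation is a shift of [c]. Shifts keep geometric
    growth, so the series and its first two derived series converge at the radius [|t| + 1]. *)
Lemma derives_egf {R : realType} (c : nat -> R) (t : R) : geometric_growth c ->
  derives (egf c) t (egf (fun n => c n.+1) t).
Proof.
move=> gc.
have diffsE (b : nat -> R) : pseries_diffs (fun n => b n / n`!%:R) =
    (fun n => b n.+1 / n`!%:R).
  apply/funext => n; rewrite /pseries_diffs factS natrM invfM mulrCA.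
  by rewrite mulVKf.
apply: derives_eq.
  apply: (@pseries_snd_diffs R (fun n => c n / n`!%:R) (`|t| + 1) t).
  - exact: cvg_egf.
  - by rewrite diffsE; apply: cvg_egf (geometric_growthS gc).
  - by rewrite !diffsE; apply: cvg_egf (geometric_growthS (geometric_growthS gc)).
  - by rewrite [ltRHS]ger0_norm ?addr_ge0 // ltrDl.
  - by [].
by rewrite diffsE.
Qed.

Lemma egf0 {R : realType} (c : nat -> R) : egf c 0 = c 0%N.
Proof.
rewrite /egf; apply: cvg_lim => //; rewrite -(cvg_shiftn 1) /=.
rewrite (_ : (fun n => _) = cst (c 0%N)); first exact: cvg_cst.
apply/funext => n; rewrite /pseries /series /= addn1 big_nat_recl //=.
rewrite fact0 expr0 divr1 mulr1 big1 ?addr0 // => i _.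
by rewrite expr0n mulr0.
Qed.

Lemma egf_lin {R : realType} (I : Type) (r : seq I) (a : I -> R)
    (c : I -> nat -> R) (t : R) : (forall i, geometric_growth (c i)) ->
  egf (fun n => \sum_(i <- r) a i * c i n) t = \sum_(i <- r) a i * egf (c i) t.
Proof.
move=> gc; rewrite /egf; apply: cvg_lim => //.
rewrite (_ : pseries _ t =
    (fun m => \sum_(i <- r) a i * pseries (fun n => c i n / n`!%:R) t m)).
  by apply: cvg_big => [|i _]; [exact: add_continuous|apply: cvgMr; exact: cvg_egf].
apply/funext => m; rewrite /pseries /series /=.
under [RHS]eq_bigr do rewrite mulr_sumr.
rewrite exchange_big /=; apply: eq_bigr => n _.
by rewrite !mulr_suml; apply: eq_bigr => i _; rewrite !mulrA.
Qed.

(** * The matrix exponential and its antiderivatives *)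

Lemma sum_mul_one {R : realType} n (v : 'rV[R]_n) :
  \sum_j v 0 j = (v *m const_mx 1 : 'cV[R]_1) 0 0.
Proof. by rewrite mxE; apply: eq_bigr => j _; rewrite mxE mulr1. Qed.

Lemma mul_one_total {R : realType} n (v : 'rV[R]_n) :
  \sum_j v 0 j = 1 -> v *m const_mx 1 = 1%:M.
Proof.
by move=> v1; apply/matrixP => a b; rewrite !ord1 -sum_mul_one v1 mxE eqxx.
Qed.

Definition mderives {R : realType} m n (X : R -> 'M[R]_(m, n)) (t : R)
    (Y : 'M[R]_(m, n)) := forall i j, derives (fun s => X s i j) t (Y i j).

Lemma mderives_eq {R : realType} m n (X Z : R -> 'M[R]_(m, n)) (t : R)
    (Y W : 'M[R]_(m, n)) :
  mderives X t Y -> X =1 Z -> Y = W -> mderives Z t W.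
Proof. by move=> + /funext <- <-. Qed.

Lemma mderives_cst {R : realType} m n (A : 'M[R]_(m, n)) (t : R) :
  mderives (fun=> A) t 0.
Proof. by move=> i j; rewrite mxE; exact: derives_cst. Qed.

Lemma mderives_mul {R : realType} m n p (X : R -> 'M[R]_(m, n))
    (Z : R -> 'M[R]_(n, p)) (t : R) X' Z' :
  mderives X t X' -> mderives Z t Z' ->
  mderives (fun s => X s *m Z s) t (X' *m Z t + X t *m Z').
Proof.
move=> dX dZ i j; apply: derives_eq.
- apply: (derives_sum (index_enum _) (P := xpredT)
    (f := fun k s => X s i k * Z s k j)
    (a := fun k => X' i k * Z t k j + X t i k * Z' k j)) => k _.
  by apply: derivesM; [exact: (dX i k)|exact: (dZ k j)].
- by move=> s; rewrite mxE.
- by rewrite !mxE -big_split.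
Qed.

Lemma mderives_mull {R : realType} m n p (A : 'M[R]_(m, n))
    (Z : R -> 'M[R]_(n, p)) (t : R) Z' :
  mderives Z t Z' -> mderives (fun s => A *m Z s) t (A *m Z').
Proof.
move=> dZ; apply: (mderives_eq (mderives_mul (mderives_cst A t) dZ)) => //.
by rewrite mul0mx add0r.
Qed.

Lemma mderives_mulr {R : realType} m n p (X : R -> 'M[R]_(m, n))
    (B : 'M[R]_(n, p)) (t : R) X' :
  mderives X t X' -> mderives (fun s => X s *m B) t (X' *m B).
Proof.
move=> dX; apply: (mderives_eq (mderives_mul dX (mderives_cst B t))) => //.
by rewrite mulmx0 addr0.
Qed.

Lemma mderivesD {R : realType} m n (X Z : R -> 'M[R]_(m, n)) (t : R) X' Z' :
  mderives X t X' -> mderives Z t Z' ->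
  mderives (fun s => X s + Z s) t (X' + Z').
Proof.
move=> dX dZ i j; apply: derives_eq; first exact: derivesD (dX i j) (dZ i j).
- by move=> s; rewrite mxE.
- by rewrite mxE.
Qed.

Lemma mderivesB {R : realType} m n (X Z : R -> 'M[R]_(m, n)) (t : R) X' Z' :
  mderives X t X' -> mderives Z t Z' ->
  mderives (fun s => X s - Z s) t (X' - Z').
Proof.
move=> dX dZ i j; apply: derives_eq; first exact: derivesB (dX i j) (dZ i j).
- by move=> s; rewrite !mxE.
- by rewrite !mxE.
Qed.

Lemma mderivesZ {R : realType} m n (f : R -> R) (X : R -> 'M[R]_(m, n))
    (t f' : R) X' :
  derives f t f' -> mderives X t X' ->
  mderives (fun s => f s *: X s) t (f' *: X t + f t *: X').
Proof.
move=> df dX i j; apply: derives_eq; first exact: derivesM df (dX i j).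
- by move=> s; rewrite mxE.
- by rewrite !mxE.
Qed.

Lemma mderives_compN {R : realType} m n (X : R -> 'M[R]_(m, n)) (t : R) X' :
  mderives X (- t) X' -> mderives (fun s => X (- s)) t (- X').
Proof.
move=> dX i j; rewrite mxE.
exact: (derives_compN (f := fun s => X s i j) (dX i j)).
Qed.

Lemma eq_of_mderives {R : realType} m n (X Z D : R -> 'M[R]_(m, n)) :
  (forall t, mderives X t (D t)) -> (forall t, mderives Z t (D t)) ->
  X 0 = Z 0 -> X =1 Z.
Proof.
move=> dX dZ XZ0 t; apply/matrixP => i j.
apply: (eq_of_derives (f := fun s => X s i j) (g := fun s => Z s i j)
  (d := fun s => D s i j)) => [s|s|].
- exact: dX.
- exact: dZ.
- by rewrite XZ0.
Qed.

Lemma geometric_growth_mx {R : realType} p (G : 'M[R]_p) i j :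
  geometric_growth (fun k => (G ^+ k) i j).
Proof.
pose K := \sum_a \sum_b `|G a b|.
exists 1, K => n; rewrite mul1r; elim: n i j => [|n IH] i j.
  by rewrite !expr0 mxE; case: eqP => _; rewrite ?normr1 ?normr0.
rewrite exprS mxE exprS (le_trans (ler_norm_sum _ _ _)) //.
rewrite (@le_trans _ _ (\sum_l `|G i l| * K ^+ n)) //.
  by apply: ler_sum => l _; rewrite normrM ler_wpM2l.
rewrite -mulr_suml ler_wpM2r //.
  by rewrite exprn_ge0 // sumr_ge0 // => a _; exact: sumr_ge0.
rewrite /K [leRHS](bigD1 i) //= lerDl sumr_ge0 // => a _; exact: sumr_ge0.
Qed.

(** Prepending a zero inverts the shift performed by differentiation, so [n] zeros produce an
    [n]-fold antiderivative vanishing at 0. *)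
Fixpoint iterated_coef {R : realType} (c : nat -> R) (n : nat) : nat -> R :=
  if n is n'.+1 then
    fun k => if k is k'.+1 then iterated_coef c n' k' else 0
  else c.

Lemma geometric_growth_iterated {R : realType} (c : nat -> R) n :
  geometric_growth c -> geometric_growth (iterated_coef c n).
Proof. by move=> gc; elim: n => //= n IH; exact: geometric_growth_cons. Qed.

(* [mexp G 0 t] is exp(tG), and [mexp G n.+1] is the antiderivative of
   [mexp G n] vanishing at 0. *)
Definition mexp {R : realType} p (G : 'M[R]_p) (n : nat) (t : R) : 'M[R]_p :=
  \matrix_(i, j) egf (iterated_coef (fun k => (G ^+ k) i j) n) t.

Lemma mexp0 {R : realType} p (G : 'M[R]_p) : mexp G 0 0 = 1%:M.
Proof. by apply/matrixP => i j; rewrite mxE egf0. Qed.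

Lemma mexpS0 {R : realType} p (G : 'M[R]_p) n : mexp G n.+1 0 = 0.
Proof. by apply/matrixP => i j; rewrite !mxE egf0. Qed.

Lemma mderives_mexpS {R : realType} p (G : 'M[R]_p) n t :
  mderives (mexp G n.+1) t (mexp G n t).
Proof.
move=> i j; rewrite mxE; apply: derives_eq.
- apply: derives_egf; apply: (@geometric_growth_iterated _ _ n.+1).
  exact: (geometric_growth_mx G i j).
- by move=> s; rewrite mxE.
- by [].
Qed.

Lemma mderives_mexp {R : realType} p (G : 'M[R]_p) t :
  mderives (mexp G 0) t (mexp G 0 t *m G).
Proof.
move=> i j; apply: derives_eq.
- exact: (derives_egf t (geometric_growth_mx G i j)).
- by move=> s; rewrite mxE.
rewrite mxE (_ : (fun k => _) =
    (fun k => \sum_l G l j * (G ^+ k) i l)); last first.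
  by apply/funext => k; rewrite exprSr mxE; apply: eq_bigr => l _; rewrite mulrC.
rewrite (egf_lin _ (fun l => G l j) _ (fun l => geometric_growth_mx G i l)).
by apply: eq_bigr => l _; rewrite mxE mulrC.
Qed.

Lemma mderives_mexp_left {R : realType} p (G : 'M[R]_p) t :
  mderives (mexp G 0) t (G *m mexp G 0 t).
Proof.
move=> i j; apply: derives_eq.
- exact: (derives_egf t (geometric_growth_mx G i j)).
- by move=> s; rewrite mxE.
rewrite mxE (_ : (fun k => _) =
    (fun k => \sum_l G i l * (G ^+ k) l j)); last first.
  by apply/funext => k; rewrite exprS mxE.
rewrite (egf_lin _ (fun l => G i l) _ (fun l => geometric_growth_mx G l j)).
by apply: eq_bigr => l _; rewrite mxE.
Qed.

(** Both sides have derivative [mexp G 0 t *m G] and vanish at 0. The identity replaces a division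
    by [G], which is impossible for a generator. *)
Lemma mexp1_mul {R : realType} p (G : 'M[R]_p) t :
  mexp G 1 t *m G = mexp G 0 t - 1%:M.
Proof.
apply: (eq_of_mderives (X := fun t => mexp G 1 t *m G)
  (Z := fun t => mexp G 0 t - 1%:M) (D := fun t => mexp G 0 t *m G)) => [s|s|].
- exact/mderives_mulr/mderives_mexpS.
- apply: (mderives_eq (mderivesB (mderives_mexp G s) (mderives_cst _ s))) => //.
  by rewrite subr0.
- by rewrite mexpS0 mul0mx mexp0 subrr.
Qed.

(** Differentiating the first factor by the right form of the derivative and the second by the left
    form puts [G] in the middle of both terms, with opposite signs. *)
Lemma mexpNK {R : realType} p (G : 'M[R]_p) t :
  mexp G 0 (-t) *m mexp G 0 t = 1%:M.
Proof.
apply: (eq_of_mderives (X := fun t => mexp G 0 (-t) *m mexp G 0 t)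
  (Z := fun=> 1%:M) (D := fun=> 0)) => [s|s|].
- apply: (mderives_eq (mderives_mul (mderives_compN (mderives_mexp G (- s)))
    (mderives_mexp_left G s))) => //.
  by rewrite mulNmx mulmxA addNr.
- exact: mderives_cst.
- by rewrite oppr0 mexp0 mulmx1.
Qed.

Lemma mexp_fix {R : realType} p n (G : 'M[R]_p) (v : 'M[R]_(p, n)) t :
  G *m v = 0 -> mexp G 0 t *m v = v.
Proof.
move=> Gv; apply: (eq_of_mderives (X := fun t => mexp G 0 t *m v)
  (Z := fun=> v) (D := fun=> 0)) => [s|s|].
- apply: (mderives_eq (mderives_mulr _ (mderives_mexp G s))) => //.
  by rewrite -mulmxA Gv mulmx0.
- exact: mderives_cst.
- by rewrite mexp0 mul1mx.
Qed.

Lemma mexp_fix_left {R : realType} p n (G : 'M[R]_p) (u : 'M[R]_(n, p)) t :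
  u *m G = 0 -> u *m mexp G 0 t = u.
Proof.
move=> uG; apply: (eq_of_mderives (X := fun t => u *m mexp G 0 t)
  (Z := fun=> u) (D := fun=> 0)) => [s|s|].
- apply: (mderives_eq (mderives_mull _ (mderives_mexp_left G s))) => //.
  by rewrite mulmxA uG mul0mx.
- exact: mderives_cst.
- by rewrite mexp0 mulmx1.
Qed.

Lemma mexp1_fix {R : realType} p n (G : 'M[R]_p) (v : 'M[R]_(p, n)) t :
  G *m v = 0 -> mexp G 1 t *m v = t *: v.
Proof.
move=> Gv; apply: (eq_of_mderives (X := fun t => mexp G 1 t *m v)
  (Z := fun s => s *: v) (D := fun=> v)) => [s|s|].
- apply: (mderives_eq (mderives_mulr _ (mderives_mexpS G 0 s))) => //.
  exact: mexp_fix.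
- apply: (mderives_eq (mderivesZ (derives_id s) (mderives_cst v s))) => //.
  by rewrite scale1r scaler0 addr0.
- by rewrite mexpS0 mul0mx scale0r.
Qed.

(** * Forward equations of a transition function *)

Lemma ler_sum_subset {R : numDomainType} (S : eqType) (a : S -> R) (r r' : seq S) :
  uniq r' -> uniq r -> {subset r' <= r} -> (forall y, 0 <= a y) ->
  \sum_(y <- r') a y <= \sum_(y <- r) a y.
Proof.
move=> ur' ur sr a0; rewrite [leRHS](bigID (mem r')) /= ler_wpDr ?sumr_ge0 //.
rewrite -[leRHS]big_filter le_eqVlt; apply/orP; left.
apply/eqP/perm_big/uniq_perm; rewrite ?filter_uniq // => y.
by rewrite mem_filter andb_idr // => /sr.
Qed.

Lemma esum_real_ub {R : realType} (S : choiceType) (a : S -> R) (v : R) (r : seq S) :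
  (\esum_(y in [set: S]) (a y)%:E = v%:E)%E -> uniq r -> \sum_(y <- r) a y <= v.
Proof.
move=> av ur; rewrite -lee_fin -av; apply: esum_ge.
exists [set` r]; first by split => //; exact: finite_seq.
by rewrite -fsbig_seq // sumEFin.
Qed.

Lemma esum_real_lub {R : realType} (S : choiceType) (a : S -> R) (v c : R) :
  (\esum_(y in [set: S]) (a y)%:E = v%:E)%E ->
  (forall r, uniq r -> \sum_(y <- r) a y <= c) -> v <= c.
Proof.
move=> av ac; rewrite -lee_fin -av; apply: ge_ereal_sup => _ [A [finA _] <-].
rewrite fsbig_finite //= sumEFin lee_fin.
by apply: ac; exact: finmap.fset_uniq.
Qed.

Lemma esum_real_adherent {R : realType} (S : choiceType) (a : S -> R) (v e : R)
    (r0 : seq S) : (forall y, 0 <= a y) ->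
  (\esum_(y in [set: S]) (a y)%:E = v%:E)%E -> 0 < e ->
  exists r, [/\ uniq r, {subset r0 <= r} & v - e < \sum_(y <- r) a y].
Proof.
move=> a0 av e0; apply: contrapT => nr.
have : v <= v - e; last by rewrite leNgt ltrBlDr ltrDl e0.
apply: (esum_real_lub av) => r ur; rewrite leNgt; apply/negP => vr; apply: nr.
exists (undup (r0 ++ r)); split; first exact: undup_uniq.
  by move=> y yr0; rewrite mem_undup mem_cat yr0.
apply: (lt_le_trans vr).
apply: ler_sum_subset => //; first exact: undup_uniq.
by move=> y yr; rewrite mem_undup mem_cat yr orbT.
Qed.

Section TransitionFunction.
Context {R : realType} (S : countType) (p : R -> S -> S -> R).
Hypothesis pT : transition_function p.

Let p_ge0 t x y : 0 <= t -> 0 <= p t x y.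
Proof. by case: pT => p0 _ _ _; exact: p0. Qed.

Let p_sum_le1 t x r : 0 <= t -> uniq r -> \sum_(y <- r) p t x y <= 1.
Proof. by case: pT => _ p1 _ _ /(p1 _ x); exact: esum_real_ub. Qed.

Lemma transition_le1 t x y : 0 <= t -> p t x y <= 1.
Proof. by move=> t0; have := p_sum_le1 x t0 (r := [:: y]) isT; rewrite big_seq1. Qed.

Lemma chapman_kolmogorov_ge s t x z r : 0 <= s -> 0 <= t -> uniq r ->
  \sum_(y <- r) p s x y * p t y z <= p (s + t) x z.
Proof.
by case: pT => _ _ _ pD s0 t0; apply: esum_real_ub; rewrite -(pD s t x z s0 t0).
Qed.

(** The states in [r] are summed exactly; the others carry at most the mass of [p s x] missing from
    [r], each with a factor at most [b]. *)
Lemma chapman_kolmogorov_le s t x z r b : 0 <= s -> 0 <= t -> uniq r ->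
  0 <= b -> (forall y, y \notin r -> p t y z <= b) ->
  p (s + t) x z <=
    \sum_(y <- r) p s x y * p t y z + b * (1 - \sum_(y <- r) p s x y).
Proof.
move=> s0 t0 ur b0 pb; case: (pT) => _ _ _ pD.
apply: (esum_real_lub (esym (pD s t x z s0 t0))) => r' ur'.
rewrite (bigID (mem r)) /= lerD //.
  rewrite -[leLHS]big_filter; apply: ler_sum_subset => //; first exact: filter_uniq.
    by move=> y; rewrite mem_filter => /andP[].
  by move=> y; rewrite mulr_ge0 // p_ge0.
rewrite -[leLHS]big_filter; set f := (X in \sum_(_ <- X) _ <= _).
apply: (@le_trans _ _ (b * \sum_(y <- f) p s x y)).
  rewrite mulr_sumr big_seq [leRHS]big_seq; apply: ler_sum => y.
  rewrite mem_filter => /andP[yr _].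
  by rewrite mulrC ler_wpM2r ?p_ge0 // pb.
rewrite ler_wpM2l // lerBrDr -big_cat p_sum_le1 // cat_uniq filter_uniq // ur andbT.
by rewrite /=; apply/hasPn => y yr; rewrite mem_filter yr.
Qed.

Lemma transition_expn (n : nat) h z : 0 <= h -> p h z z ^+ n <= p (n%:R * h) z z.
Proof.
case: (pT) => _ _ p00 _ h0; elim: n => [|n IH].
  by rewrite mul0r p00 eqxx expr0.
rewrite -[n.+1%:R]natr1 mulrDl mul1r exprSr.
have := @chapman_kolmogorov_ge (n%:R * h) h z z [:: z].
rewrite big_seq1; move=> /(_ _ h0 isT) H; apply: le_trans (H _); last first.
  exact: mulr_ge0.
by rewrite ler_wpM2r // p_ge0.
Qed.

Context (q : S -> S -> R) (pq : has_rates p q).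

(* The exit probability over [0, n d] is at most n times the one over [0, d],
   by Bernoulli's inequality; let d tend to 0. *)
Lemma transition_stay h z : 0 <= h -> 1 - p h z z <= - q z z * h.
Proof.
rewrite le_eqVlt => /predU1P[<-|h0].
  by case: (pT) => _ _ p00 _; rewrite p00 eqxx subrr mulr0.
apply/ler_addgt0Pr => e e0.
have eh0 : 0 < e / h by rewrite divr_gt0.
have /cvgrPdist_le/(_ _ eh0) := @pq z z.
rewrite near_withinE => -[d /= d0 dP].
pose n := (Num.truncn (h / d)).+1.
have n0 : 0 < n%:R :> R by rewrite ltr0n.
have hn0 : 0 < h / n%:R by rewrite divr_gt0.
have hnd : h / n%:R < d.
  by rewrite ltr_pdivrMr // mulrC -ltr_pdivrMr // truncnS_gt.
have := dP (h / n%:R); rewrite /ball /= sub0r normrN gtr0_norm // => /(_ hnd hn0).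
rewrite eqxx; set x := p _ z z => xq.
have x0 : 0 <= x by apply: p_ge0; exact: ltW.
have x1 : x <= 1 by apply: transition_le1; exact: ltW.
have bern m : 1 - m%:R * (1 - x) <= x ^+ m.
  elim: m => [|m IH]; first by rewrite mul0r subr0 expr0.
  have xm1 : x ^+ m <= 1 by exact: exprn_ile1.
  rewrite exprS -natr1; nra.
have := transition_expn n z (ltW hn0); rewrite -/x mulrC divfK ?gt_eqF // => xn.
have := bern n => bn.
have : n%:R * (1 - x) <= (- q z z + e / h) * h.
  have -> : n%:R * (1 - x) = (1 - x) / (h / n%:R) * h.
    by field; rewrite !gt_eqF.
  rewrite ler_pM2r //; move: xq; rewrite ler_norml => /andP[_].
  by rewrite -(opprB x) mulNr mulr1n; lra.
rewrite mulrDl divfK ?gt_eqF //; lra.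
Qed.

Context (K : R) (qK : forall z, - q z z <= K).

Lemma transition_diff h z y : 0 <= h -> `|p h z y - (z == y)%:R| <= K * h.
Proof.
move=> h0; have stay : 1 - p h z z <= K * h.
  by apply: le_trans (transition_stay z h0) _; rewrite ler_wpM2r.
have [<-|zy] := eqVneq z y.
  by rewrite distrC ger0_norm // subr_ge0 transition_le1.
rewrite subr0 ger0_norm ?p_ge0 //; apply: le_trans stay; rewrite lerBrDr.
have := p_sum_le1 z h0 (r := [:: y; z]).
by rewrite big_cons big_seq1 /= inE eq_sym zy; apply.
Qed.

Lemma rate_bound_ge0 : S -> 0 <= K.
Proof.
by move=> z; have := transition_diff z z ler01; rewrite mulr1; apply: le_trans.
Qed.

(** From a state outside [r], hence different from [y], the state [y] is reached within time [h]
    with probability at most [K * h]. After division by [h] the error is thus [K] times the missing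
    mass, which a large [r] makes small; this reduces the infinite sum to a finite one. *)
Lemma chapman_kolmogorov_approx s h x y r : 0 <= s -> 0 <= h -> uniq r -> y \in r ->
  0 <= p (s + h) x y - p s x y - \sum_(z <- r) p s x z * (p h z y - (z == y)%:R)
    <= K * h * (1 - \sum_(z <- r) p s x z).
Proof.
move=> s0 h0 ur yr.
have -> : \sum_(z <- r) p s x z * (p h z y - (z == y)%:R) =
    \sum_(z <- r) p s x z * p h z y - p s x y.
  under eq_bigr do rewrite mulrBr.
  rewrite sumrB (big_rem y) //=; congr (_ - _).
  rewrite (bigD1_seq y) //= eqxx mulr1 big1 ?addr0 // => z /negbTE ->.
  by rewrite mulr0.
rewrite opprB addrA subrK subr_ge0 chapman_kolmogorov_ge //=.
rewrite lerBlDl chapman_kolmogorov_le ?mulr_ge0 ?rate_bound_ge0 // => z zr.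
have := transition_diff z y h0; rewrite (_ : z == y = false) ?subr0.
  by move/ler_normlW.
by apply: contraNF zr => /eqP ->.
Qed.

Lemma transition_lipschitz s h x y : 0 <= s -> 0 <= h ->
  `|p (s + h) x y - p s x y| <= K * h.
Proof.
move=> s0 h0; have := chapman_kolmogorov_approx x s0 h0 (r := [:: y]) isT (mem_head _ _).
rewrite !big_seq1 eqxx mulr1n => /andP[lo hi].
have ps0 := p_ge0 x y s0; have ps1 := transition_le1 x y s0.
have := transition_diff y y h0; rewrite eqxx mulr1n ler_norml => /andP[dlo _].
have := transition_le1 y y h0 => dhi.
have Kh0 : 0 <= K * h by rewrite mulr_ge0 // rate_bound_ge0.
have Kh1 : 0 <= K * h * p s x y by rewrite mulr_ge0.
rewrite ler_norml; apply/andP; split; nra.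
Qed.

(** The base point [s h] may move with [h], so that one statement serves both one-sided quotients at
    [t]: the right one with [s h = t] and the left one with [s h = t - h]. *)
Lemma forward_quotient (s : R -> R) t x y r :
  (\forall h \near 0^'+, 0 <= s h) -> 0 <= t ->
  (forall z, p (s h) x z @[h --> 0^'+] --> p t x z) ->
  uniq r -> (forall z, z \notin r -> q z y = 0) ->
  (p (s h + h) x y - p (s h) x y) / h @[h --> 0^'+] -->
    \sum_(z <- r) p t x z * q z y.
Proof.
move=> s0 t0 ps ur qr; have K0 := rate_bound_ge0 y.
have K1 : 0 < K + 1 by rewrite ltr_wpDl.
apply/cvgrPdist_le => e e0.
(* Error budget: e/2 for the mass missing from [r'], and e/4 for each of the two limits [cA] and
   [cB]. Dividing by [K + 1] covers the case [K = 0]. *)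
have d0 : 0 < e / 2 / (K + 1) by rewrite !divr_gt0.
have [r' [ur' rr' r'1]] : exists r', [/\ uniq r', {subset y :: r <= r'} &
    1 - e / 2 / (K + 1) < \sum_(z <- r') p t x z].
  apply: esum_real_adherent => //; first by move=> z; exact: p_ge0.
  by case: (pT) => _ p1 _ _; exact: p1.
have -> : \sum_(z <- r) p t x z * q z y = \sum_(z <- r') p t x z * q z y.
  rewrite [RHS](bigID (mem r)) /= [X in _ + X]big1 ?addr0 => [|z /qr ->]; last first.
    by rewrite mulr0.
  rewrite -[RHS]big_filter; apply/perm_big/uniq_perm; rewrite ?filter_uniq // => z.
  by rewrite mem_filter andb_idr // => zr; apply: rr'; rewrite inE zr orbT.
have cA : \sum_(z <- r') p (s h) x z * ((p h z y - (z == y)%:R) / h) @[h --> 0^'+]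
    --> \sum_(z <- r') p t x z * q z y.
  apply: cvg_big => [|z _]; first exact: add_continuous.
  by apply: cvgM; [exact: ps|exact: pq].
have cB : K * (1 - \sum_(z <- r') p (s h) x z) @[h --> 0^'+]
    --> K * (1 - \sum_(z <- r') p t x z).
  apply: cvgMl_tmp; apply: cvgB; first exact: cvg_cst.
  by apply: cvg_big => [|z _]; [exact: add_continuous|exact: ps].
have e4 : 0 < e / 4 by rewrite divr_gt0.
have limB : K * (1 - \sum_(z <- r') p t x z) <= e / 2.
  apply: (@le_trans _ _ (K * (e / 2 / (K + 1)))).
    by rewrite ler_wpM2l // lerBlDr -lerBlDl ltW.
  by rewrite mulrCA ler_piMr ?divr_ge0 ?(ltW e0) // ler_pdivrMr // mul1r lerDl.
move/cvgrPdist_le : cA => /(_ _ e4) cA; move/cvgrPdist_le : cB => /(_ _ e4) cB.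
near=> h.
have h0 : 0 < h by near: h; exact: nbhs_right_gt.
have sh0 : 0 <= s h by near: h.
have : `|\sum_(z <- r') p t x z * q z y -
    \sum_(z <- r') p (s h) x z * ((p h z y - (z == y)%:R) / h)| <= e / 4.
  by near: h.
have : `|K * (1 - \sum_(z <- r') p t x z) -
    K * (1 - \sum_(z <- r') p (s h) x z)| <= e / 4.
  by near: h.
have yr' : y \in r' by apply: rr'; exact: mem_head.
have /andP[] := chapman_kolmogorov_approx x sh0 (ltW h0) ur' yr'.
have -> : \sum_(z <- r') p (s h) x z * ((p h z y - (z == y)%:R) / h) =
    (\sum_(z <- r') p (s h) x z * (p h z y - (z == y)%:R)) / h.
  by rewrite mulr_suml; apply: eq_bigr => z _; rewrite mulrA.
set P := p (s h + h) x y - p (s h) x y; set Q := \sum_(z <- r') _ * (_ - _).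
set B := 1 - \sum_(z <- r') p (s h) x z.
rewrite subr_ge0 -(ler_pM2r (x := h^-1)) ?invr_gt0 // => lo.
rewrite -(ler_pM2r (x := h^-1)) ?invr_gt0 // mulrBl mulrAC mulfK ?gt_eqF // => hi.
rewrite !ler_norml => /andP[b1 b2] /andP[a1 a2].
apply/andP; split; lra.
Unshelve. all: by end_near. Qed.

Lemma forward_right_continuous x y : p h x y @[h --> 0^'+] --> p 0 x y.
Proof.
have K0 := rate_bound_ge0 y; have K1 : 0 < K + 1 by rewrite ltr_wpDl.
apply/cvgrPdist_le => e e0; near=> h.
have h0 : 0 <= h by near: h; exact: nbhs_right_ge.
have := transition_lipschitz x y (lexx 0) h0; rewrite add0r distrC => /le_trans -> //.
apply: (@le_trans _ _ ((K + 1) * h)); first by rewrite ler_wpM2r // lerDl.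
rewrite mulrC -ler_pdivlMr //; near: h; apply: nbhs_right_le.
by rewrite divr_gt0.
Unshelve. all: by end_near. Qed.

(* The forward equation is obtained from the right difference quotients at t
   and at t - h. *)
Lemma forward_equation t x y r : 0 < t ->
  uniq r -> (forall z, z \notin r -> q z y = 0) ->
  derives (fun s => p s x y) t (\sum_(z <- r) p t x z * q z y).
Proof.
move=> t0 ur qr; set L := \sum_(z <- r) _.
have K0 := rate_bound_ge0 y; have K1 : 0 < K + 1 by rewrite ltr_wpDl.
have right : (p (t + h) x y - p t x y) / h @[h --> 0^'+] --> L.
  apply: (forward_quotient (s := fun=> t)) => //; first exact: nearW (fun=> ltW t0).
  - exact: ltW.
  - by move=> z; exact: cvg_cst.
have left : (p (t - h + h) x y - p (t - h) x y) / h @[h --> 0^'+] --> L.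
  apply: (forward_quotient (s := fun h => t - h)) => //.
  - by near=> h; rewrite subr_ge0; near: h; exact: nbhs_right_le.
  - exact: ltW.
  - move=> z; apply/cvgrPdist_le => e e0; near=> h.
    have h0 : 0 <= h by near: h; exact: nbhs_right_ge.
    have th0 : 0 <= t - h by rewrite subr_ge0; near: h; exact: nbhs_right_le.
    have := transition_lipschitz x z th0 h0; rewrite subrK => /le_trans -> //.
    apply: (@le_trans _ _ ((K + 1) * h)); first by rewrite ler_wpM2r // lerDl.
    rewrite mulrC -ler_pdivlMr //; near: h; apply: nbhs_right_le.
    by rewrite divr_gt0.
have both : (p (t + h) x y - p t x y) / h @[h --> 0^'] --> L.
  apply: (@cvg_at_right_left_dnbhs _ R^o) => //; apply/cvg_at_leftNP; rewrite oppr0.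
  apply: cvg_trans left; apply: near_eq_cvg; apply: nearW => h /=.
  by rewrite subrK invrN mulrN -mulNr opprB.
have {}both : h^-1 *: (p (h *: 1 + t) x y - p t x y) @[h --> 0^'] --> L.
  apply: cvg_trans both; apply: near_eq_cvg; apply: nearW => h /=.
  by rewrite /GRing.scale /= mulr1 (addrC h) mulrC.
split; last exact: (cvg_lim _ both).
by apply/cvg_ex; exists L.
Unshelve. all: by end_near. Qed.
End TransitionFunction.

(** * From MAPs to forward systems *)

(** Only the level sets of [N t] are assumed measurable. They form a countable partition on each
    piece of which the integrand is constant, which gives both its measurability and the series. *)
Lemma moment_series {R : realType} d (T : measurableType d) (P : probability T R)
    (N : R -> T -> nat) (k : nat) (t : R) (a : nat -> R) (l : R) :
  (forall n, measurable [set w | N t w = n]) ->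
  (forall n, P [set w | N t w = n] = (a n)%:E) ->
  (fun M => \sum_(0 <= n < M) n%:R ^+ k * a n) @ \oo --> l ->
  moment P N k t = l%:E.
Proof.
move=> mN Pa al; rewrite /moment unlock.
pose F n := [set w | N t w = n].
have FT : \bigcup_n F n = setT by apply/seteqP; split => // w _; exists (N t w).
pose f w : \bar R := ((N t w)%:R ^+ k)%:E.
have mf n : measurable_fun (F n) f.
  apply: (eq_measurable_fun (cst (n%:R ^+ k)%:E)); last exact: measurable_cst.
  by move=> w; rewrite inE /f => <-.
rewrite -FT ge0_integral_bigcup //.
- transitivity (\sum_(0 <= n <oo) (n%:R ^+ k * a n)%:E)%E.
    apply: eq_eseriesr => n _.
    rewrite (eq_integral (cst (n%:R ^+ k)%:E)); last first.
      by move=> w; rewrite inE => <-.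
    rewrite (integral_cst P (mN n)) EFinM; congr (_ * _)%E; exact: Pa.
  apply: cvg_lim => //.
  have -> : (fun M => \sum_(0 <= n < M) (n%:R ^+ k * a n)%:E)%E =
      EFin \o (fun M => \sum_(0 <= n < M) n%:R ^+ k * a n).
    by apply/funext => M; rewrite /= sumEFin.
  by apply: cvg_EFin => //; exact: nearW.
- exact/measurable_fun_bigcup.
- apply/trivIsetP => i j _ _ ij; rewrite -subset0 => w [Ni Nj].
  by move: ij; rewrite -Ni -Nj eqxx.
Qed.

Lemma measure_ord_partition {R : realType} d (T : measurableType d)
    (P : probability T R) m (Y : T -> 'I_m) (B : set T) :
  measurable B -> (forall i, measurable [set w | Y w = i]) ->
  P B = (\sum_(i < m) P (B `&` [set w | Y w = i]))%E.
Proof.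
move=> mB mY; have mBY i : measurable (B `&` [set w | Y w = i]) by exact: measurableI.
rewrite -measure_semi_additive_ord //.
- congr (P _); apply/seteqP; split => [w Bw|w].
    by rewrite -bigcup_seq; exists (Y w) => //=; rewrite mem_index_enum.
  by rewrite -bigcup_seq => -[i _ []].
- apply/trivIsetP => i j _ _ ij; rewrite -subset0 => w [[_ Yi] [_ Yj]].
  by move: ij; rewrite -Yi -Yj eqxx.
- exact: bigsetU_measurable.
Qed.

(* [A n t 0 j] plays the role of the probability of being in state (n, j) at
   time t. *)
Definition forward_system {R : realType} m (C D : 'M[R]_m) (eta : 'rV[R]_m)
    (A : nat -> R -> 'rV[R]_m) : Prop :=
  [/\ forall n t j, 0 <= t -> 0 <= A n t 0 j,
      forall n t, 0 < t -> mderives (A n) t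
        (A n t *m C + (if n is n'.+1 then A n' t *m D else 0)),
      forall n j, A n t 0 j @[t --> 0^'+] --> A n 0 0 j
    & forall n, A n 0 = if n is 0%N then eta else 0].

Lemma MAP_forward {R : realType} d (T : measurableType d) (P : probability T R) m
    (eta : 'rV[R]_m) (C D : 'M[R]_m) (N : R -> T -> nat) (X : R -> T -> 'I_m) :
  (forall i, 0 <= eta 0 i) -> MAP P eta C D N X ->
  exists A, forward_system C D eta A /\
    forall n t, 0 <= t -> measurable [set w | N t w = n] /\
      P [set w | N t w = n] = (\sum_j A n t 0 j)%:E.
Proof.
move=> eta0 [_ N0 PX0 [mZ _ [p [pT pq fdd]]]].
(* The total rate out of (n, i) is [- C i i] whatever n is, so a single bound serves the infinite
   state space. *)
have rateE i : - MAP_rates C D i i <= \sum_j `|C j j|.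
  rewrite /MAP_rates eqxx (bigD1 i.2) //= ler_wpDr ?sumr_ge0 //.
  by rewrite -normrN ler_norm.
exists (fun n t => \row_j \sum_i eta 0 i * p t (0%N, i) (n, j)).
split; first split.
- move=> n t j t0; rewrite mxE sumr_ge0 // => i _.
  by case: (pT) => p0 _ _ _; rewrite mulr_ge0 // p0.
- move=> n t t0 i j; rewrite !ord1 {i}.
  (* Nonzero rates into (n, j) come only from the levels n and n - 1; they yield the terms with [C]
     and [D] respectively. *)
  pose r : seq (nat * 'I_m) := [seq (n, l) | l <- index_enum _] ++
    (if n is n'.+1 then [seq (n', l) | l <- index_enum _] else [::]).
  have ur : uniq r.
    rewrite /r; case: (n) => [|n'].
      by rewrite cats0 map_inj_uniq ?index_enum_uniq // => a b [].
    rewrite cat_uniq !map_inj_uniq ?index_enum_uniq //=; try by move=> a b [].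
    rewrite andbT; apply/hasPn => z /mapP[l _ ->]; apply/negP => /mapP[l' _ []].
    by move=> /eqP; rewrite ltn_eqF.
  have qr z : z \notin r -> MAP_rates C D z (n, j) = 0.
    case: z => [k l]; rewrite /MAP_rates /= /r mem_cat negb_or => /andP[zn zn'].
    case: eqP => [nk|_].
      case/negP: zn; apply/mapP; exists l; first exact: mem_index_enum.
      by rewrite nk.
    case: eqP => [nk|//]; case/negP: zn'; rewrite nk; apply/mapP.
    by exists l; first exact: mem_index_enum.
  apply: derives_eq.
  + apply: (derives_sum (index_enum _) (P := xpredT)
      (f := fun i s => eta 0 i * p s (0%N, i) (n, j))
      (a := fun i => eta 0 i * \sum_(z <- r) p t (0%N, i) z * MAP_rates C D z (n, j))).
    move=> i _; apply: derivesMl.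
    exact: (forward_equation pT pq rateE (0%N, i) t0 ur qr).
  + by move=> s; rewrite mxE.
  + have part k (B : 'M[R]_m) : (forall l, MAP_rates C D (k, l) (n, j) = B l j) ->
        \sum_i eta 0 i * (\sum_l p t (0%N, i) (k, l) * MAP_rates C D (k, l) (n, j)) =
        ((\row_j \sum_i eta 0 i * p t (0%N, i) (k, j)) *m B) 0 j.
      move=> Bk; rewrite mxE; under [RHS]eq_bigr do rewrite mxE mulr_suml.
      rewrite exchange_big; apply: eq_bigr => i _.
      by rewrite mulr_sumr; apply: eq_bigr => l _; rewrite Bk mulrA.
    rewrite mxE -(part n C) => [|l]; last by rewrite /MAP_rates /= eqxx.
    rewrite /r; case: (n) part => [|n'] part.
      rewrite mxE addr0; apply: eq_bigr => i _.
      by rewrite cats0 big_map.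
    rewrite -(part n' D) => [|l]; last first.
      by rewrite /MAP_rates /= eqxx gtn_eqF.
    rewrite -big_split /=; apply: eq_bigr => i _.
    by rewrite big_cat /= !big_map mulrDr.
- move=> n j; rewrite mxE.
  under eq_fun do rewrite mxE.
  apply: cvg_big => [|i _]; first exact: add_continuous.
  apply: cvgMl_tmp; exact: (forward_right_continuous pT pq rateE).
- move=> n; apply/rowP => j; rewrite mxE; case: (pT) => _ _ p00 _.
  under eq_bigr do rewrite p00.
  case: n => [|n]; last by rewrite mxE big1 // => i _; rewrite mulr0.
  rewrite (bigD1 j) //= eqxx mulr1 big1 ?addr0 // => i ij.
  by rewrite xpair_eqE eqxx (negbTE ij) mulr0.
move=> n t t0.
have mNj j : measurable [set w | N t w = n /\ X t w = j].
  have := mZ t (n, j) t0; congr measurable; apply/seteqP.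
  by split => w /= [-> ->].
have mX0 i : measurable [set w | X 0 w = i].
  have := mZ 0 (0%N, i) (lexx _); congr measurable; apply/seteqP.
  by split => w /=; [case|move=> ->; rewrite N0].
have mXt i : measurable [set w | X t w = i].
  rewrite (_ : [set w | _] = \bigcup_k [set w | (N t w, X t w) = (k, i)]).
    by apply: bigcup_measurable => k _; exact: mZ.
  apply/seteqP; split => [w /= <-|w [k _ /= [_ ->]] //].
  by exists (N t w).
have mN : measurable [set w | N t w = n].
  rewrite (_ : [set w | _] = \big[setU/set0]_(j < m) [set w | N t w = n /\ X t w = j]).
    exact: bigsetU_measurable.
  rewrite -bigcup_seq; apply/seteqP; split => [w /= Nw|w [j _ [] //]].
  by exists (X t w) => //=; rewrite mem_index_enum.
split => //.
rewrite (measure_ord_partition P mN mXt) -sumEFin; apply: eq_bigr => j _.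
rewrite mxE (measure_ord_partition P (mNj j) mX0) -sumEFin.
apply: eq_bigr => i _; rewrite EFinM -PX0.
(* The joint law at the two times 0 and [t]; every index past 0 is sent to time [t]. *)
have := fdd 0%N (fun k => if k is 0%N then 0 else t)
  (fun k => if k is 0%N then (0%N, i) else (n, j)) (lexx _).
rewrite subr0 => fddE.
transitivity (P [set w | forall k, (k <= 1)%N ->
    (N (if k is 0%N then 0 else t) w, X (if k is 0%N then 0 else t) w) =
    (if k is 0%N then (0%N, i) else (n, j))]).
  congr (P _); apply/seteqP; split => w /=.
    by move=> [[Nw Xw] X0w] [|[|]] // _; rewrite ?N0 ?X0w ?Nw ?Xw.
  by move=> H; have [_ ->] := H 0%N isT; have [-> ->] := H 1%N isT.
rewrite fddE; last by case.
congr (P _ * _)%E; apply/seteqP; split => w /=.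
  by move=> /(_ 0%N isT)[].
by move=> X0w [|//] _; rewrite N0 X0w.
Qed.

(** * Initial value problems and a Gronwall estimate *)

(** Transition functions are unconstrained at negative times, so no two-sided derivative is
    available at 0; right continuity there is what connects the equation to the initial value. *)
Definition ivp {R : realType} m n (X Y : R -> 'M[R]_(m, n)) :=
  (forall t, 0 < t -> mderives X t (Y t)) /\
  (forall i j, X t i j @[t --> 0^'+] --> X 0 i j).

Lemma ivp_nonincr {R : realType} (f d : R -> R) (T : R) : 0 <= T ->
  (forall t, 0 < t -> derives f t (d t)) -> f t @[t --> 0^'+] --> f 0 ->
  (forall t, 0 < t < T -> d t <= 0) -> f T <= f 0.
Proof.
rewrite le_eqVlt => /predU1P[<- //|T0] fd f0 d0.
apply: (nonincr_of_derives (d := d)); rewrite ?(ltW T0) //.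
  by move=> t /andP[t0 _]; exact: fd.
apply/continuous_within_itvP => //; split => //.
  move=> t; rewrite in_itv /= => /andP[t0 _].
  exact: (derives_continuous (fd t t0)).
by apply: cvg_at_left_filter; exact: (derives_continuous (fd T T0)).
Qed.

Lemma ivp_eq {R : realType} m n (X Y X' Y' : R -> 'M[R]_(m, n)) :
  ivp X Y -> (forall t, X t = X' t) -> (forall t, 0 < t -> Y t = Y' t) -> ivp X' Y'.
Proof.
move=> [dX cX] /funext <- YY; split => // t t0.
by rewrite -YY //; exact: dX.
Qed.

Lemma ivp_mderives {R : realType} m n (X Y : R -> 'M[R]_(m, n)) :
  (forall t, mderives X t (Y t)) -> ivp X Y.
Proof.
move=> dX; split => [t _|i j]; first exact: dX.
by apply: cvg_at_right_filter; exact: (derives_continuous (dX 0 i j)).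
Qed.

Lemma ivpD {R : realType} m n (X Y X' Y' : R -> 'M[R]_(m, n)) :
  ivp X Y -> ivp X' Y' -> ivp (fun t => X t + X' t) (fun t => Y t + Y' t).
Proof.
move=> [dX cX] [dX' cX']; split => [t t0|i j].
  by apply: mderivesD; [exact: dX|exact: dX'].
by under eq_fun do rewrite mxE; rewrite mxE; apply: cvgD; [exact: cX|exact: cX'].
Qed.

Lemma ivp_mulr {R : realType} m n p (X Y : R -> 'M[R]_(m, n)) (B : 'M[R]_(n, p)) :
  ivp X Y -> ivp (fun t => X t *m B) (fun t => Y t *m B).
Proof.
move=> [dX cX]; split => [t t0|i j].
  exact/mderives_mulr/dX.
under eq_fun do rewrite mxE; rewrite mxE.
apply: cvg_big => [|k _]; first exact: add_continuous.
by apply: cvgMr_tmp; exact: cX.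
Qed.

Lemma ivpZ {R : realType} m n (c : R) (X Y : R -> 'M[R]_(m, n)) :
  ivp X Y -> ivp (fun t => c *: X t) (fun t => c *: Y t).
Proof.
move=> XY; apply: (ivp_eq (ivp_mulr (c%:M) XY)) => [t|t _];
  by rewrite mul_mx_scalar.
Qed.

Lemma ivpB {R : realType} m n (X Y X' Y' : R -> 'M[R]_(m, n)) :
  ivp X Y -> ivp X' Y' -> ivp (fun t => X t - X' t) (fun t => Y t - Y' t).
Proof.
move=> XY /(ivpZ (-1)) XY'; apply: (ivp_eq (ivpD XY XY')) => [t|t _];
  by rewrite scaleN1r.
Qed.

Lemma sum_pairs {R : comNzRingType} n (x : 'I_n -> R) (w c : R) :
  \sum_k (\sum_i w * (x i + x k) + (x k + c)) =
  (n%:R * w *+ 2 + 1) * \sum_k x k + n%:R * c.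
Proof.
transitivity (\sum_k ((w * n%:R + 1) * x k + (w * \sum_i x i + c))).
  apply: eq_bigr => k _; rewrite -mulr_sumr big_split /= sumr_const card_ord.
  by rewrite -mulr_natl; ring.
rewrite big_split /= -mulr_sumr sumr_const card_ord -[_ *+ n]mulr_natl.
by ring.
Qed.

(** Energy estimate on the squared Euclidean norm [phi], which is differentiable where a norm need
    not be. The constant [B] is chosen before [e], [r] and [del], so it serves all truncation levels
    at once. *)
Lemma gronwall {R : realType} n (W : 'M[R]_n) (T : R) : 0 <= T ->
  exists2 B : R, 0 <= B & forall (e r : R -> 'rV[R]_n) (del : R),
    ivp e (fun t => e t *m W + r t) -> e 0 = 0 ->
    (forall t j, 0 <= t <= T -> `|r t 0 j| <= del) ->
    forall t j, 0 <= t <= T -> e t 0 j ^+ 2 <= B * del ^+ 2.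
Proof.
move=> T0; pose w := \sum_i \sum_j `|W i j|.
have w0 : 0 <= w by apply: sumr_ge0 => i _; exact: sumr_ge0.
have Ww i j : `|W i j| <= w.
  rewrite /w (bigD1 i) //= (bigD1 j) //= -addrA lerDl addr_ge0 ?sumr_ge0 //.
  by move=> k _; exact: sumr_ge0.
pose K := n%:R * w *+ 2 + 1.
have K0 : 0 <= K by rewrite addr_ge0 // mulrn_wge0 // mulr_ge0.
exists (n%:R * T * expR (K * T)); first by rewrite !mulr_ge0 ?expR_ge0.
move=> e r del [de ce] e0 rdel t j /andP[t0 tT].
pose phi s := \sum_j e s 0 j ^+ 2.
pose dphi s := \sum_j (2 * e s 0 j * (e s *m W + r s) 0 j).
have dphiE s : 0 < s -> derives phi s (dphi s).
  move=> s0; apply: derives_sum => k _.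
  apply: (derives_eq (derivesM (de s s0 0 k) (de s s0 0 k))).
    by move=> ?; rewrite expr2.
  by ring.
have phi_ge0 s : 0 <= phi s by apply: sumr_ge0 => k _; exact: sqr_ge0.
have dphi_le s : 0 < s < T -> dphi s <= K * phi s + n%:R * del ^+ 2.
  move=> /andP[s0 sT].
  have rs k : `|r s 0 k| <= del by apply: rdel; rewrite !ltW.
  (* The quadratic part adds the inequalities [(e_i + e_k)^2 (w - W_ik) >= 0] and
     [(e_i - e_k)^2 (w + W_ik) >= 0]; the forcing part is [2 e_k r_k <= e_k^2 + r_k^2]. *)
  have term k : 2 * e s 0 k * (e s *m W + r s) 0 k <=
      \sum_i w * (e s 0 i ^+ 2 + e s 0 k ^+ 2) + (e s 0 k ^+ 2 + del ^+ 2).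
    rewrite !mxE mulrDr lerD //.
      rewrite mulr_sumr; apply: ler_sum => i _.
      have := Ww i k; rewrite ler_norml => /andP[W1 W2].
      have : 0 <= (e s 0 i + e s 0 k) ^+ 2 * (w - W i k).
        by rewrite mulr_ge0 ?sqr_ge0 // subr_ge0.
      have : 0 <= (e s 0 i - e s 0 k) ^+ 2 * (w + W i k).
        by rewrite mulr_ge0 ?sqr_ge0 // -(opprK w) addrC subr_ge0.
      by rewrite -subr_ge0 => h1 h2; nra.
    have : 0 <= (e s 0 k - r s 0 k) ^+ 2 by exact: sqr_ge0.
    have : r s 0 k ^+ 2 <= del ^+ 2.
      by rewrite -real_normK ?num_real // lerXn2r // nnegrE (le_trans _ (rs k)).
    by nra.
  rewrite /dphi (le_trans (ler_sum _ (fun k _ => term k))) //.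
  by rewrite sum_pairs.
have phi00 : phi 0 = 0.
  by rewrite /phi big1 // => k _; rewrite e0 mxE expr0n.
(* With the integrating factor, [phi' <= K phi + n del^2] makes [psi] nonincreasing, since
   [expR (- (K * s))] is at most 1. *)
pose psi s := phi s * expR (- (K * s)) - n%:R * del ^+ 2 * s.
have dK s : is_derive s (1 : R) (fun x : R => - (K * x)) (- K).
  by apply: (derives_eq (derivesMl (- K) (derives_id s))) => [x|];
    rewrite ?mulNr ?mulr1.
have dE s : derives (fun x => expR (- (K * x))) s (- K * expR (- (K * s))).
  apply: derives_eq.
  - exact: (@is_derive1_comp R expR (fun x => - (K * x)) s _ _ (is_derive_expR _) (dK s)).
  - by [].
  - by rewrite /= mulrC.
have H : psi t <= psi 0.
  apply: (ivp_nonincr (d := fun s => (dphi s * expR (- (K * s)) +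
    phi s * (- K * expR (- (K * s)))) - n%:R * del ^+ 2 * 1)) => //.
  - move=> s s0; apply: derivesB; last exact: derivesMl (derives_id s).
    by apply: derivesM; first exact: dphiE.
  - apply: cvgB; last first.
      apply: cvg_at_right_filter.
      exact: (derives_continuous (derivesMl _ (derives_id 0))).
    apply: cvgM; last first.
      by apply: cvg_at_right_filter; exact: (derives_continuous (dE 0)).
    apply: cvg_big => [|k _]; first exact: add_continuous.
    by rewrite expr2; under eq_fun do rewrite expr2; apply: cvgM; exact: ce.
  - move=> s /andP[s0 st].
    have sT : 0 < s < T by rewrite s0 (lt_le_trans st).
    have := dphi_le _ sT.
    have E0 := expR_gt0 (- (K * s)).
    have E1 : expR (- (K * s)) <= 1 by rewrite expR_le1 oppr_le0 mulr_ge0 // ltW.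
    have nd : 0 <= n%:R * del ^+ 2 by rewrite mulr_ge0 ?sqr_ge0.
    by nra.
have {H} phit : phi t <= n%:R * del ^+ 2 * t * expR (K * t).
  move: H; rewrite /psi phi00 mul0r mulr0 subrr subr_le0 expRN.
  by rewrite ler_pdivrMr ?expR_gt0.
apply: (@le_trans _ _ (phi t)).
  by rewrite /phi (bigD1 j) //= lerDl sumr_ge0 // => k _; exact: sqr_ge0.
apply: (le_trans phit).
have -> : n%:R * T * expR (K * T) * del ^+ 2 = n%:R * del ^+ 2 * T * expR (K * T).
  by ring.
apply: ler_pM; rewrite ?expR_ge0 //.
- by apply: mulr_ge0 => //; apply: mulr_ge0; rewrite ?sqr_ge0.
- by rewrite ler_wpM2l // mulr_ge0 ?sqr_ge0.
- by rewrite ler_expR ler_wpM2l.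
Qed.

(** * Binomial moments of a forward system *)

Definition uniformly_null {R : realType} n (T : R) (e : nat -> R -> 'rV[R]_n) :=
  forall eps, 0 < eps -> exists M0 : nat, forall M t j, (M0 <= M)%N ->
    0 <= t <= T -> `|e M t 0 j| <= eps.

Lemma uniformly_nullD {R : realType} n (T : R) (e f : nat -> R -> 'rV[R]_n) :
  uniformly_null T e -> uniformly_null T f ->
  uniformly_null T (fun M t => e M t + f M t).
Proof.
move=> e0 f0 eps eps0; have eps2 : 0 < eps / 2 by rewrite divr_gt0.
have [M1 eM1] := e0 _ eps2; have [M2 fM2] := f0 _ eps2.
exists (maxn M1 M2) => M t j; rewrite geq_max => /andP[M1M M2M] tT.
rewrite mxE (le_trans (ler_normD _ _)) // (splitr eps) lerD //.
  exact: eM1.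
exact: fM2.
Qed.

Lemma uniformly_null_mulr {R : realType} n m (T : R) (e : nat -> R -> 'rV[R]_n)
    (B : 'M[R]_(n, m)) :
  uniformly_null T e -> uniformly_null T (fun M t => e M t *m B).
Proof.
move=> e0 eps eps0; pose b := \sum_i \sum_j `|B i j| + 1.
have b0 : 0 < b.
  by rewrite ltr_wpDl // sumr_ge0 // => i _; exact: sumr_ge0.
have [M0 eM0] := e0 _ (divr_gt0 eps0 b0).
exists M0 => M t j M0M tT; rewrite mxE (le_trans (ler_norm_sum _ _ _)) //.
apply: (@le_trans _ _ (\sum_i eps / b * `|B i j|)).
  by apply: ler_sum => i _; rewrite normrM ler_wpM2r // eM0.
rewrite -mulr_sumr -mulrA ler_piMr ?(ltW eps0) // mulrC ler_pdivrMr // mul1r.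
rewrite /b ler_wpDr //; apply: ler_sum => i _.
by rewrite (bigD1 j) //= lerDl sumr_ge0.
Qed.

Lemma uniformly_nullN {R : realType} n (T : R) (e : nat -> R -> 'rV[R]_n) :
  uniformly_null T e -> uniformly_null T (fun M t => - e M t).
Proof.
by move=> e0 eps /e0[M0 eM0]; exists M0 => M t j; rewrite mxE normrN; exact: eM0.
Qed.

Lemma uniformly_nullB {R : realType} n (T : R) (e f : nat -> R -> 'rV[R]_n) :
  uniformly_null T e -> uniformly_null T f ->
  uniformly_null T (fun M t => e M t - f M t).
Proof. by move=> e0 /uniformly_nullN; exact: uniformly_nullD. Qed.

Lemma uniformly_null_gronwall {R : realType} n (T : R) (W : 'M[R]_n)
    (e r : nat -> R -> 'rV[R]_n) : 0 <= T ->
  (forall M, ivp (e M) (fun t => e M t *m W + r M t)) ->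
  (forall M, e M 0 = 0) -> uniformly_null T r -> uniformly_null T e.
Proof.
move=> T0 de e0 r0 eps eps0; have [B B0 gron] := gronwall W T0.
have B1 : 0 < 1 + B by rewrite ltr_wpDr.
(* Dividing by [1 + B] avoids a square root: [B <= (1 + B) ^+ 2]. *)
have [M0 rM0] := r0 _ (divr_gt0 eps0 B1).
exists M0 => M t j M0M tT.
have := gron _ _ _ (de M) (e0 M) (fun t j => rM0 M t j M0M) t j tT.
move=> H.
rewrite -(ler_pXn2r (n := 2)) ?nnegrE ?(ltW eps0) // real_normK ?num_real //.
apply: (le_trans H); rewrite expr_div_n mulrA ler_pdivrMr ?exprn_gt0 //.
rewrite mulrC ler_wpM2l ?sqr_ge0 // -subr_ge0.
have -> : (1 + B) ^+ 2 - B = 1 + B + B ^+ 2 by ring.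
by rewrite !addr_ge0 ?sqr_ge0.
Qed.

(** Passing from ['C(M.+1, k)] to ['C(M, k)] costs a factor [(M + 1) / (M + 1 - k)], at most 2 here,
    and [(M - k) 'C(M, k) = (k + 1) 'C(M, k + 1)]. The top term of a moment is thus of order 1/M
    relative to that of the next moment. *)
Lemma bin_succ_bound k M : (k.*2 <= M)%N ->
  ((M - k) * 'C(M.+1, k) <= (k.+1).*2 * 'C(M, k.+1))%N.
Proof.
move=> kM; have kM1 : (0 < M.+1 - k)%N.
  by rewrite subn_gt0 ltnS (leq_trans _ kM) // -addnn leq_addr.
rewrite -(leq_pmul2l kM1).
have -> : ((M.+1 - k) * ((M - k) * 'C(M.+1, k)) = M.+1 * (k.+1 * 'C(M, k.+1)))%N.
  by rewrite mulnCA -(mul_bin_down M.+1 k) mulnCA -(mul_bin_left M k).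
rewrite -doubleMl -doubleMr doubleMl leq_mul2r; apply/orP; right.
by rewrite -addnn addnBA ?leq_subRL; lia.
Qed.

Section ForwardSystem.
Context {R : realType} (m : nat) (C D : 'M[R]_m) (eta : 'rV[R]_m).
Context (lam : 'cV[R]_m) (A : nat -> R -> 'rV[R]_m).
Hypothesis fA : forward_system C D eta A.
Hypothesis QE : (C + D) *m const_mx 1 = 0 :> 'cV[R]_m.
Hypothesis DE : D *m const_mx 1 = lam.
Hypothesis lam_ge0 : forall i, 0 <= lam i 0.
Hypothesis eta1 : \sum_j eta 0 j = 1.

Let one : 'cV[R]_m := const_mx 1.

Let mul_one (v : 'rV[R]_m) : (v *m one) 0 0 = \sum_j v 0 j.
Proof. by rewrite mxE; apply: eq_bigr => j _; rewrite mxE mulr1. Qed.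

Definition binomial_moment k M t : 'rV[R]_m :=
  \sum_(n < M.+1) 'C(n, k)%:R *: A n t.

(** The flow from level M into the discarded level M + 1, with the weight it would have had
    there. *)
Definition truncation_error k M t : 'rV[R]_m := 'C(M.+1, k)%:R *: A M t *m D.

Lemma binomial_moment0 k M : binomial_moment k M 0 = if k is 0%N then eta else 0.
Proof.
case: fA => _ _ _ A0; rewrite /binomial_moment big_ord_recl /= A0 big1 ?addr0.
  by case: k => [|k]; rewrite ?bin0 ?bin0n ?scale1r ?scale0r.
by move=> i _; rewrite A0 scaler0.
Qed.

(** Shifting the index in the terms with [D] produces ['C(n.+1, k)], which Pascal's rule splits into
    the contributions to the moments [k] and [k - 1]; the shift overshoots by the single term of
    level M + 1. *)
Lemma binomial_moment_ivp k M : ivp (binomial_moment k M) (fun t =>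
  binomial_moment k M t *m (C + D) +
  (if k is k'.+1 then binomial_moment k' M t *m D else 0) -
  truncation_error k M t).
Proof.
have Aivp n : ivp (A n) (fun t => A n t *m C + (if n is n'.+1 then A n' t *m D else 0)).
  case: fA => _ dA cA _; split => [t t0|i j]; first exact: dA.
  by rewrite !ord1; exact: cA.
rewrite /binomial_moment /truncation_error; elim: M => [|M IH].
  apply: (ivp_eq (ivpZ 'C(0, k)%:R (Aivp 0%N))) => [t|t _].
    by rewrite big_ord1.
  rewrite !big_ord1 addr0 mulmxDr -!scalemxAl; case: k => [|k].
    by rewrite !bin0 !scale1r addr0 addrK.
  rewrite big_ord1 binS !bin0n /= -scalemxAl.
  by rewrite add0n !scale0r !add0r subrr.
apply: (ivp_eq (ivpD IH (ivpZ 'C(M.+1, k)%:R (Aivp M.+1)))) => [t|t _].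
  by rewrite [RHS]big_ord_recr.
rewrite [in RHS]big_ord_recr /= mulmxDl scalerDr.
case: k IH => [|k] _.
  rewrite !bin0 !scale1r !mulmxDr !addr0.
  move: (A M.+1 t *m C) (A M.+1 t *m D) (A M t *m D) => a b c.
  move: (_ *m C) (_ *m D) => x y.
  by apply/rowP => j; rewrite !mxE; ring.
rewrite (big_ord_recr M.+1) /= (binS M.+1) natrD !mulmxDl -!scalemxAl !mulmxDr.
move: (A M.+1 t *m C) (A M.+1 t *m D) (A M t *m D) => a b c.
set S := \sum_(_ < _) _; set S' := \sum_(_ < _) _.
move: (S *m C) (S *m D) (S' *m D) => x y z.
by apply/rowP => j; rewrite !mxE; ring.
Qed.

Lemma binomial_moment_ge0 k M t j : 0 <= t -> 0 <= binomial_moment k M t 0 j.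
Proof.
move=> t0; case: fA => A0 _ _ _; rewrite summxE sumr_ge0 // => n _.
by rewrite mxE mulr_ge0 // A0.
Qed.

(** In the totals the generator disappears and the truncation error has a favourable sign, so the
    derivative of the k-th total is at most [L] times the previous total. The resulting bound is
    independent of M. *)
Lemma binomial_moment_total_le k M t (L : R) : 0 <= L ->
  (forall i, lam i 0 <= L) -> 0 <= t ->
  \sum_j binomial_moment k M t 0 j <= (L * t) ^+ k.
Proof.
move=> L0 lamL t0.
have tot_le l (s : R) : 0 <= s ->
    (binomial_moment l M s *m lam) 0 0 <= L * \sum_j binomial_moment l M s 0 j.
  move=> s0; rewrite mxE mulr_sumr; apply: ler_sum => i _.
  by rewrite mulrC ler_wpM2r // binomial_moment_ge0.
have err_ge0 l (s : R) : 0 < s -> 0 <= (truncation_error l M s *m one) 0 0.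
  move=> s0; rewrite /truncation_error -mulmxA DE mxE sumr_ge0 // => i _.
  case: fA => A0 _ _ _; rewrite mxE; apply: mulr_ge0; last exact: lam_ge0.
  by apply: mulr_ge0 => //; apply: A0; exact: ltW.
elim: k t t0 => [|k IH] t t0.
  have [dB cB] := ivp_mulr one (binomial_moment_ivp 0 M).
  rewrite -(mul_one (binomial_moment 0 M t)) expr0 -eta1 -(mul_one eta).
  rewrite -(binomial_moment0 0 M).
  apply: (ivp_nonincr t0 (fun s s0 => dB s s0 0 0) (cB 0 0)) => s /andP[s0 st].
  rewrite addr0 mulmxBl -mulmxA QE mulmx0 sub0r mxE oppr_le0; exact: err_ge0.
have [dB cB] := ivp_mulr one (binomial_moment_ivp k.+1 M).
rewrite -(mul_one (binomial_moment k.+1 M t)) -subr_le0.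
pose f s := (binomial_moment k.+1 M s *m one) 0 0 - (L * s) ^+ k.+1.
have Lpow s : derives (fun s => (L * s) ^+ k.+1) s (k.+1%:R * (L * s) ^+ k * L).
  apply: derives_eq.
  - exact: (is_deriveX k.+1 (derivesMl L (derives_id s))).
  - by move=> x; rewrite exprfctE.
  - by rewrite /GRing.scale /= mulr1.
rewrite -[leLHS]/(f t) (_ : 0 = f 0); last first.
  by rewrite /f binomial_moment0 mul0mx mxE mulr0 expr0n subrr.
apply: (ivp_nonincr t0 (fun s s0 => derivesB (dB s s0 0 0) (Lpow s))).
  apply: cvgB; first exact: cB.
  by apply: cvg_at_right_filter; exact: (derives_continuous (Lpow 0)).
move=> s /andP[s0 st]; rewrite mulmxBl mulmxDl -mulmxA QE mulmx0 add0r -mulmxA DE.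
rewrite mxE [X in _ + X - _]mxE subr_le0.
apply: (@le_trans _ _ (L * (L * s) ^+ k)).
  rewrite -[leRHS]addr0 lerD ?oppr_le0 ?err_ge0 // (le_trans (tot_le _ _ (ltW s0))) //.
  by rewrite ler_wpM2l // IH // ltW.
(* The derivative of [(L * s) ^+ k.+1] carries a factor [k.+1], here bounded below by 1. *)
rewrite mulrC ler_wpM2r // ler_peMl ?exprn_ge0 ?mulr_ge0 ?(ltW s0) //.
by rewrite ler1n.
Qed.
(** By [bin_succ_bound], the error is at most a constant over [M - k] times the top term of the
    moment [k.+1], itself bounded uniformly in M. *)
Lemma truncation_error_null k (T : R) : 0 <= T ->
  uniformly_null T (truncation_error k).
Proof.
move=> T0; pose L := \sum_i lam i 0; pose d := \sum_i \sum_j `|D i j|.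
have L0 : 0 <= L by exact: sumr_ge0.
have lamL i : lam i 0 <= L by rewrite /L (bigD1 i) //= lerDl sumr_ge0.
have Dd i j : `|D i j| <= d.
  rewrite /d (bigD1 i) //= (bigD1 j) //= -addrA lerDl addr_ge0 ?sumr_ge0 //.
  by move=> l _; exact: sumr_ge0.
have d0 : 0 <= d by apply: sumr_ge0 => i _; exact: sumr_ge0.
pose B := (k.+1).*2%:R * (L * T) ^+ k.+1 * d.
have B0 : 0 <= B by rewrite !mulr_ge0 ?exprn_ge0 ?mulr_ge0.
(* The first summand ensures [2k < M], as [bin_succ_bound] requires; the second makes [M - k] exceed
   [B / eps]. *)
move=> eps eps0; exists (k.*2.+1 + Num.truncn (B / eps))%N => M t j MM /andP[t0 tT].
have Mk : (k.*2 < M)%N by exact: leq_trans (leq_addr _ _) MM.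
have Mk0 : 0 < (M - k)%:R :> R by rewrite ltr0n subn_gt0; clear -Mk; lia.
have [A0 _ _ _] := fA.
pose a := \sum_i A M t 0 i.
have a0 : 0 <= a by apply: sumr_ge0 => i _; exact: A0.
have le_tot : 'C(M, k.+1)%:R * a <= (L * T) ^+ k.+1.
  apply: (@le_trans _ _ ((L * t) ^+ k.+1)); last first.
    by rewrite lerXn2r ?nnegrE ?mulr_ge0 // ler_wpM2l.
  apply: le_trans (binomial_moment_total_le k.+1 M L0 lamL t0).
  rewrite mulr_sumr; apply: ler_sum => i _.
  rewrite /binomial_moment big_ord_recr /= mxE [X in _ + X]mxE lerDr summxE.
  by apply: sumr_ge0 => n _; rewrite mxE mulr_ge0 // A0.
have err : `|truncation_error k M t 0 j| <= 'C(M.+1, k)%:R * a * d.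
  rewrite /truncation_error mxE (le_trans (ler_norm_sum _ _ _)) //.
  rewrite -mulrA mulr_suml mulr_sumr.
  apply: ler_sum => i _; rewrite mxE !normrM -mulrA ger0_norm // ler_wpM2l //.
  by rewrite ger0_norm ?A0 // ler_wpM2l // A0.
apply: (le_trans err); rewrite -(ler_pM2l Mk0).
apply: (@le_trans _ _ B).
  rewrite !mulrA /B ler_wpM2r //.
  apply: (@le_trans _ _ ((k.+1).*2%:R * ('C(M, k.+1)%:R * a))); last exact: ler_wpM2l.
  rewrite mulrA ler_wpM2r // -!natrM ler_nat.
  exact: bin_succ_bound (ltnW Mk).
rewrite -ler_pdivrMr //; apply: (le_trans (ltW (truncnS_gt _))).
rewrite ler_nat; move: (Num.truncn _) MM => b MM; clear -MM; lia.
Qed.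

Hypothesis eta_stat : eta *m (C + D) = 0.

Lemma binomial_moment0_limit (T : R) : 0 <= T ->
  uniformly_null T (fun M t => binomial_moment 0 M t - eta).
Proof.
move=> T0; apply: (uniformly_null_gronwall (W := C + D)
  (r := fun M t => - truncation_error 0 M t)) => // [M|M|].
- apply: (ivp_eq (ivpB (binomial_moment_ivp 0 M) (ivp_mderives (mderives_cst eta)))).
    by [].
  by move=> t t0; rewrite subr0 addr0 mulmxBl eta_stat subr0.
- by rewrite binomial_moment0 subrr.
- exact/uniformly_nullN/truncation_error_null.
Qed.

Lemma binomial_moment1_limit (T : R) : 0 <= T ->
  uniformly_null T
    (fun M t => binomial_moment 1 M t - eta *m D *m mexp (C + D) 1 t).
Proof.
move=> T0; apply: (uniformly_null_gronwall (W := C + D)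
  (r := fun M t => (binomial_moment 0 M t - eta) *m D - truncation_error 1 M t)) => //.
- move=> M; apply: (ivp_eq (ivpB (binomial_moment_ivp 1 M)
    (ivp_mderives (fun t => mderives_mull (eta *m D) (mderives_mexpS (C + D) 0 t))))).
    by [].
  (* This exhibits [eta *m D *m mexp (C + D) 1 t] as the solution of [x' = x (C + D) + eta D] with
     [x(0) = 0]. *)
  move=> t t0; have -> : mexp (C + D) 0 t = mexp (C + D) 1 t *m (C + D) + 1%:M.
    by rewrite mexp1_mul subrK.
  rewrite mulmxDr mulmx1 !mulmxA !mulmxBl.
  move: (eta *m D) (eta *m D *m mexp (C + D) 1 t *m (C + D)) => a b.
  move: (truncation_error 1 M t) (binomial_moment 0 M t *m D) => c e.
  move: (binomial_moment 1 M t *m (C + D)) => f.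
  by apply/rowP => j; rewrite !mxE; ring.
- by move=> M; rewrite binomial_moment0 mexpS0 mulmx0 subrr.
- apply: uniformly_nullB; last exact: truncation_error_null.
  exact/uniformly_null_mulr/binomial_moment0_limit.
Qed.
End ForwardSystem.

(** * Comparison of the two processes *)

Lemma uniformly_null_cvg {R : realType} n (T : R) (e : nat -> R -> 'rV[R]_n) j :
  0 <= T -> uniformly_null T e -> (fun M => e M T 0 j) @ \oo --> (0 : R).
Proof.
move=> T0 e0; apply/cvgrPdist_le => eps /e0[M0 eM0].
exists M0 => // M /= M0M; rewrite sub0r normrN; apply: eM0 => //.
by rewrite T0 lexx.
Qed.

Section Comparison.
Context {R : realType} (p : nat) (G Lam : 'M[R]_p) (eta : 'rV[R]_p).
Context (A B : nat -> R -> 'rV[R]_p).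
Hypothesis fA : forward_system (G - Lam) Lam eta A.
Hypothesis fB : forward_system (- Lam) (G + Lam) eta B.
Let one : 'cV[R]_p := const_mx 1.
Hypothesis G1 : G *m one = 0.
Hypothesis lam_ge0 : forall i, 0 <= (Lam *m one) i 0.
Hypothesis eta1 : \sum_j eta 0 j = 1.
Hypothesis eta_stat : eta *m G = 0.

Let QA : G - Lam + Lam = G. Proof. by rewrite subrK. Qed.
Let QB : - Lam + (G + Lam) = G. Proof. by rewrite addrC addrK. Qed.
Let QA1 : (G - Lam + Lam) *m one = 0. Proof. by rewrite QA. Qed.
Let QB1 : (- Lam + (G + Lam)) *m one = 0. Proof. by rewrite QB. Qed.
Let DB1 : (G + Lam) *m one = Lam *m one. Proof. by rewrite mulmxDl G1 add0r. Qed.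
Let etaA : eta *m (G - Lam + Lam) = 0. Proof. by rewrite QA. Qed.
Let etaB : eta *m (- Lam + (G + Lam)) = 0. Proof. by rewrite QB. Qed.
Let u := eta *m Lam.
Let errA k T : 0 <= T -> uniformly_null T (truncation_error Lam A k).
Proof. exact: (truncation_error_null fA QA1 (erefl _) lam_ge0 eta1). Qed.
Let errB k T : 0 <= T -> uniformly_null T (truncation_error (G + Lam) B k).
Proof. exact: (truncation_error_null fB QB1 DB1 lam_ge0 eta1). Qed.

Let limA1 T : 0 <= T ->
  uniformly_null T (fun M t => binomial_moment A 1 M t - u *m mexp G 1 t).
Proof.
move=> T0; have := binomial_moment1_limit fA QA1 (erefl _) lam_ge0 eta1 etaA T0.
by rewrite QA.
Qed.

Let limB1 T : 0 <= T ->
  uniformly_null T (fun M t => binomial_moment B 1 M t - u *m mexp G 1 t).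
Proof.
move=> T0; have := binomial_moment1_limit fB QB1 DB1 lam_ge0 eta1 etaB T0.
by rewrite QB mulmxDr eta_stat add0r.
Qed.

(** The solution of [x' = x G + u J G] with [x(0) = 0], where [J] is [mexp G 1]. The forcing term is
    the limit of the difference between [b_1 (G + Lam)] and [b_1 Lam], as both [b_1] tend to
    [u J]. *)
Let w t := t *: (u *m mexp G 0 t) - u *m mexp G 1 t.

Lemma second_moment_gap (T : R) : 0 <= T ->
  uniformly_null T
    (fun M t => binomial_moment B 2 M t - binomial_moment A 2 M t - w t).
Proof.
move=> T0; apply: (uniformly_null_gronwall (W := G)
  (r := fun M t => (binomial_moment B 1 M t - u *m mexp G 1 t) *m (G + Lam)
     - (binomial_moment A 1 M t - u *m mexp G 1 t) *m Lam
     - truncation_error (G + Lam) B 2 M t + truncation_error Lam A 2 M t)) => //.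
- move=> M.
  have dw t : mderives w t (t *: (u *m mexp G 0 t *m G)).
    apply: (mderives_eq (mderivesB (mderivesZ (derives_id t)
      (mderives_mull u (mderives_mexp G t))) (mderives_mull u (mderives_mexpS G 0 t)))).
      by [].
    by rewrite scale1r addrC addKr mulmxA.
  apply: (ivp_eq (ivpB (ivpB (binomial_moment_ivp fB 2 M) (binomial_moment_ivp fA 2 M))
    (ivp_mderives dw))) => [//|t t0].
  rewrite QA QB /w !mulmxBl -!scalemxAl !mulmxDr.
  move: (truncation_error _ _ _ _ _) (truncation_error _ _ _ _ _) => a b.
  move: (u *m mexp G 0 t *m G) (u *m mexp G 1 t *m G) (u *m mexp G 1 t *m Lam).
  move: (binomial_moment B 2 M t *m G) (binomial_moment A 2 M t *m G).
  move: (binomial_moment B 1 M t *m G) (binomial_moment B 1 M t *m Lam).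
  move: (binomial_moment A 1 M t *m Lam) => c1 c2 c3 c4 c5 c6 c7 c8.
  by apply/rowP => j; rewrite !mxE; ring.
- move=> M; rewrite (binomial_moment0 fA) (binomial_moment0 fB) /w scale0r mexpS0.
  by rewrite mulmx0 !subrr.
- apply: uniformly_nullD; last exact: errA.
  apply: uniformly_nullB; last exact: errB.
  by apply: uniformly_nullB; apply: uniformly_null_mulr; [exact: limB1|exact: limA1].
Qed.

(** Since [G 1 = 0], the derivative of the difference of totals tends to [w Lam 1]. The factor 2
    makes the displayed expression its antiderivative: the derivative of [t J] contributes an extra
    [J]. *)
Lemma third_moment_gap (T : R) : 0 <= T ->
  uniformly_null T (fun M t =>
    (binomial_moment B 3 M t - binomial_moment A 3 M t) *m one -
    (t *: (u *m mexp G 1 t) - 2 *: (u *m mexp G 2 t)) *m (Lam *m one)).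
Proof.
move=> T0; apply: (uniformly_null_gronwall (W := 0)
  (r := fun M t =>
     (binomial_moment B 2 M t - binomial_moment A 2 M t - w t) *m (Lam *m one)
     - truncation_error (G + Lam) B 3 M t *m one
     + truncation_error Lam A 3 M t *m one)) => //.
- move=> M.
  have dd t : mderives (fun t =>
      (t *: (u *m mexp G 1 t) - 2 *: (u *m mexp G 2 t)) *m (Lam *m one)) t
      (w t *m (Lam *m one)).
    apply: (mderives_eq (mderives_mulr (Lam *m one) (mderivesB (mderivesZ (derives_id t)
      (mderives_mull u (mderives_mexpS G 0 t))) (mderivesZ (derives_cst 2 t)
      (mderives_mull u (mderives_mexpS G 1 t)))))).
      by [].
    congr (_ *m _); rewrite /w scale1r scale0r add0r.
    by apply/rowP => j; rewrite !mxE; ring.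
  apply: (ivp_eq (ivpB (ivp_mulr one (ivpB (binomial_moment_ivp fB 3 M)
    (binomial_moment_ivp fA 3 M))) (ivp_mderives dd))) => [//|t t0].
  rewrite QA QB mulmx0 add0r !mulmxBl !mulmxDl -!(mulmxA _ G) -!(mulmxA _ Lam).
  rewrite -!(mulmxA _ (G + Lam)) DB1 G1 !mulmx0 !add0r.
  do 6 move: (_ *m (Lam *m one)) => ?.
  by apply/rowP => j; rewrite !mxE; ring.
- move=> M; rewrite (binomial_moment0 fA) (binomial_moment0 fB) subrr mul0mx.
  by rewrite scale0r mexpS0 mulmx0 scaler0 subrr mul0mx subrr.
- apply: uniformly_nullD; last exact/uniformly_null_mulr/errA.
  apply: uniformly_nullB; last exact/uniformly_null_mulr/errB.
  exact/uniformly_null_mulr/second_moment_gap.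
Qed.

Lemma total_binomial_gap k (T l : R) : 0 <= T ->
  match k with
  | 1 | 2 => l = 0
  | 3 => l = ((T *: (u *m mexp G 1 T) - 2 *: (u *m mexp G 2 T)) *m (Lam *m one)) 0 0
  | _ => False
  end ->
  (fun M => \sum_j binomial_moment B k M T 0 j -
            \sum_j binomial_moment A k M T 0 j) @ \oo --> l.
Proof.
move=> T0 kl.
suff [e [e0 eE]] : exists e : nat -> R -> 'rV[R]_1, uniformly_null T e /\
    forall M, e M T 0 0 + l = \sum_j binomial_moment B k M T 0 j -
            \sum_j binomial_moment A k M T 0 j.
  under eq_fun do rewrite -eE.
  have : (fun M => e M T 0 0 + l) @ \oo --> 0 + l.
    by apply: cvgD; [exact: uniformly_null_cvg|exact: cvg_cst].
  by rewrite add0r.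
have entryB (a b : 'cV[R]_1) : (a - b) 0 0 = a 0 0 - b 0 0 by rewrite !mxE.
case: k kl => [//|[->|[->|[->|//]]]].
- exists (fun M t => ((binomial_moment B 1 M t - u *m mexp G 1 t) -
    (binomial_moment A 1 M t - u *m mexp G 1 t)) *m one); split.
    by apply/uniformly_null_mulr/uniformly_nullB; [exact: limB1|exact: limA1].
  by move=> M; rewrite addr0 opprB addrA subrK mulmxBl entryB !sum_mul_one.
- exists (fun M t => (binomial_moment B 2 M t - binomial_moment A 2 M t - w t) *m one).
  split; first exact/uniformly_null_mulr/second_moment_gap.
  move=> M; rewrite addr0 !mulmxBl !entryB !sum_mul_one -[RHS]subr0; congr (_ - _).
  (* The phasewise gap [w] has total zero because exp(tG) fixes the vector of ones and its
     antiderivative multiplies it by t. *)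
  by rewrite -scalemxAl -!mulmxA (mexp_fix _ G1) (mexp1_fix _ G1) -!scalemxAr subrr.
- exists (fun M t => (binomial_moment B 3 M t - binomial_moment A 3 M t) *m one -
    (t *: (u *m mexp G 1 t) - 2 *: (u *m mexp G 2 t)) *m (Lam *m one)).
  split; first exact: third_moment_gap.
  by move=> M; rewrite entryB subrK mulmxBl entryB !sum_mul_one.
Qed.
End Comparison.

(** * Power moments from binomial moments *)

Lemma sqr_binomial n : (n ^ 2 = 2 * 'C(n, 2) + 'C(n, 1))%N.
Proof.
elim: n => [//|n IH]; rewrite !binS bin0 bin1; move: IH; rewrite bin1.
by rewrite !expnS !expn0; nia.
Qed.

Lemma cube_binomial n : (n ^ 3 = 6 * 'C(n, 3) + 6 * 'C(n, 2) + 'C(n, 1))%N.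
Proof.
elim: n => [//|n IH]; have := sqr_binomial n; move: IH.
rewrite !binS bin0 !bin1 !expnS !expn0; move: 'C(n, 3) 'C(n, 2) => a b.
nia.
Qed.

(** The truncated totals increase with M and are bounded, hence converge. This also shows the
    moments to be finite, so that their differences can be formed in [R]. *)
Lemma forward_moments {R : realType} d (T : measurableType d) (P : probability T R)
    (N : R -> T -> nat) m (C D : 'M[R]_m) (eta : 'rV[R]_m)
    (A : nat -> R -> 'rV[R]_m) (t : R) :
  forward_system C D eta A ->
  (C + D) *m const_mx 1 = 0 :> 'cV[R]_m ->
  (forall i, 0 <= (D *m const_mx 1 : 'cV[R]_m) i 0) ->
  \sum_j eta 0 j = 1 -> 0 <= t ->
  (forall n, measurable [set w | N t w = n] /\
     P [set w | N t w = n] = (\sum_j A n t 0 j)%:E) ->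
  exists l : nat -> R,
    [/\ forall k, (fun M => \sum_j binomial_moment A k M t 0 j) @ \oo --> l k,
        moment P N 1 t = (l 1%N)%:E,
        moment P N 2 t = (2 * l 2%N + l 1%N)%:E
      & moment P N 3 t = (6 * l 3%N + 6 * l 2%N + l 1%N)%:E].
Proof.
move=> fA QE lam0 eta1 t0 PN; have [A0 _ _ _] := fA.
set lam := D *m const_mx 1 in lam0.
pose L := \sum_i lam i 0.
have L0 : 0 <= L by exact: sumr_ge0.
have lamL i : lam i 0 <= L by rewrite /L (bigD1 i) //= lerDl sumr_ge0.
pose a n := \sum_j A n t 0 j.
have a0 n : 0 <= a n by apply: sumr_ge0 => j _; exact: A0.
pose b k M := \sum_j binomial_moment A k M t 0 j.
have bE k M : b k M = \sum_(0 <= n < M.+1) 'C(n, k)%:R * a n.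
  rewrite /b big_mkord; under eq_bigr do rewrite summxE.
  rewrite exchange_big; apply: eq_bigr => n _; rewrite mulr_sumr.
  by apply: eq_bigr => j _; rewrite mxE.
have cb k : cvgn (b k).
  apply: nondecreasing_is_cvgn.
    apply/nondecreasing_seqP => M; rewrite !bE [leRHS]big_nat_recr //= lerDl.
    by rewrite mulr_ge0.
  exists ((L * t) ^+ k) => _ [M _ <-].
  exact: (binomial_moment_total_le fA QE (erefl _) lam0 eta1).
pose l k := limn (b k).
have bl k : b k @ \oo --> l k by exact: cb.
have mom k (c : R) : (fun M => \sum_(0 <= n < M.+1) n%:R ^+ k * a n) @ \oo --> c ->
    moment P N k t = c%:E.
  move=> ac; apply: (moment_series (a := a)) => [n|n|].
  - by have [] := PN n.
  - by have [] := PN n.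
  - by rewrite -cvg_shiftS.
exists l; split => //.
- apply: mom; have := bl 1%N; apply: cvg_trans; apply: near_eq_cvg.
  apply: nearW => M; rewrite bE; apply: eq_bigr => n _.
  by rewrite bin1 expr1.
- apply: mom; have : 2 * b 2%N M + b 1%N M @[M --> \oo] --> 2 * l 2%N + l 1%N.
    by apply: cvgD => //; exact: cvgMl_tmp.
  apply: cvg_trans; apply: near_eq_cvg; apply: nearW => M.
  rewrite !bE mulr_sumr -big_split; apply: eq_bigr => n _ /=.
  by rewrite -natrX sqr_binomial natrD natrM; ring.
- apply: mom; have : 6 * b 3%N M + 6 * b 2%N M + b 1%N M @[M --> \oo] -->
      6 * l 3%N + 6 * l 2%N + l 1%N.
    by apply: cvgD => //; apply: cvgD; exact: cvgMl_tmp.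
  apply: cvg_trans; apply: near_eq_cvg; apply: nearW => M.
  rewrite !bE !mulr_sumr -!big_split; apply: eq_bigr => n _ /=.
  by rewrite -natrX cube_binomial 2!natrD 2!natrM; ring.
Qed.

(** * Lumping the MTCP *)

(** The intertwining relations carry [K] through both terms of the forward equation, and
    nonnegativity of [K] preserves that of the entries. *)
Lemma forward_system_mulr {R : realType} m n (C D : 'M[R]_m) (C' D' : 'M[R]_n)
    (K : 'M[R]_(m, n)) (eta : 'rV[R]_m) (A : nat -> R -> 'rV[R]_m) :
  (forall i j, 0 <= K i j) -> C *m K = K *m C' -> D *m K = K *m D' ->
  forward_system C D eta A ->
  forward_system C' D' (eta *m K) (fun n t => A n t *m K).
Proof.
move=> K0 CK DK [A0 dA cA Ai]; split.
- by move=> k t j t0; rewrite mxE sumr_ge0 // => i _; rewrite mulr_ge0 ?A0.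
- move=> k t t0; apply: (mderives_eq (mderives_mulr K (dA k t t0))) => //.
  rewrite mulmxDl -!mulmxA CK; congr (_ + _).
  by case: k => [|k]; rewrite ?mul0mx // -!mulmxA DK.
- move=> k j; have Aivp : ivp (A k) (fun t => A k t *m C +
      (if k is k'.+1 then A k' t *m D else 0)).
    by split => [t t0|i l]; [exact: dA|rewrite !ord1; exact: cA].
  by have [_ c] := ivp_mulr K Aivp; exact: c.
- by move=> k; rewrite Ai; case: k => [|k]; rewrite ?mul0mx.
Qed.

Section BlockSum.
Context {R : realType} (p : nat) (G : 'M[R]_p) (lam : 'rV[R]_p).
Hypothesis G_gen : generator G.

(* Summing over the two phases of each block is a lumping of the MTCP: the
   lumped process is a MAP with generator G again, and event matrix G + Lam. *)
Definition block_sum : 'M[R]_(\sum_(i < p) 2, p) :=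
  \mxcol_(i < p) \matrix_(a < 2, j < p) (i == j)%:R.

Lemma block_sumE s j : block_sum s j = (tagnat.sig1 s == j)%:R.
Proof. by rewrite !mxE. Qed.

Lemma block_sum_mul n (B : 'M[R]_(p, n)) s j :
  (block_sum *m B) s j = B (tagnat.sig1 s) j.
Proof.
rewrite mxE (bigD1 (tagnat.sig1 s)) //= block_sumE eqxx mul1r big1 ?addr0 //.
by move=> l ls; rewrite block_sumE eq_sym (negbTE ls) mul0r.
Qed.

Lemma exit_rateE i : G i i = - exit_rate G i.
Proof.
case: G_gen => _ /(_ i); rewrite (bigD1 i) //= => /eqP; rewrite addr_eq0.
by move/eqP.
Qed.

(** Both rows of the i-th diagonal block sum to [- lambda_i + (lambda_i - S_i) = - S_i = G i i], and
    both rows of block (i, j) to [G i j]: row sums are constant within each block. *)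
Lemma MTCP_Q_block_sum : MTCP_Q G lam *m block_sum = block_sum *m G.
Proof.
rewrite /MTCP_Q /block_sum mul_mxblock_mxrow -/block_sum.
apply/matrixP => s l; rewrite block_sum_mul mxE summxE.
move: (tagnat.sig1 s) (tagnat.sig2 s) => i a.
rewrite (bigD1 l) //= [X in _ + X]big1 ?addr0 => [|j jl]; last first.
  by rewrite mxE big1 // => b _; rewrite [X in _ * X]mxE (negbTE jl) mulr0.
rewrite mxE; under eq_bigr do rewrite [X in _ * X]mxE eqxx mulr1.
rewrite big_ord_recl big_ord1.
have [<-|il] := eqVneq i l; last first.
  by rewrite !mxE; case: a => [[|[|]]] //= _; rewrite ?mulr1n ?mulr0n ?addr0 ?add0r.
rewrite !mxE exit_rateE.
by case: a => [[|[|]]] //= _; ring.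
Qed.

Lemma MTCP_C_block_sum : MTCP_C G lam *m block_sum = block_sum *m (- diag_mx lam).
Proof.
apply/matrixP => s l; rewrite block_sum_mul mul_diag_mx !mxE !eqxx mxE eqxx.
by case: eqP => [->|_]; rewrite ?mulr1 ?mulr1n ?mulr0 ?mulr0n ?oppr0.
Qed.

Lemma MTCP_D_block_sum :
  MTCP_D G lam *m block_sum = block_sum *m (G + diag_mx lam).
Proof.
rewrite /MTCP_D mulmxBl MTCP_Q_block_sum -/(MTCP_C G lam) MTCP_C_block_sum.
by rewrite mulmxN opprK mulmxDr.
Qed.

Lemma MTCP_generator : MTCP_C G lam + MTCP_D G lam = MTCP_Q G lam.
Proof. by rewrite /MTCP_D addrC subrK. Qed.

Lemma block_sum_one : block_sum *m const_mx 1 = const_mx 1 :> 'cV[R]_(\sum_(i < p) 2).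
Proof. by apply/matrixP => s l; rewrite block_sum_mul !mxE. Qed.

Lemma block_sum_stationary (eta : 'rV[R]_(\sum_(i < p) 2)) :
  stationary_distribution (MTCP_Q G lam) eta ->
  stationary_distribution G (eta *m block_sum).
Proof.
move=> [eta0 eta1 etaQ]; split.
- move=> i; rewrite mxE sumr_ge0 // => s _.
  by rewrite block_sumE mulr_ge0.
- by rewrite sum_mul_one -mulmxA block_sum_one -sum_mul_one.
- by rewrite -mulmxA -MTCP_Q_block_sum mulmxA etaQ mul0mx.
Qed.
End BlockSum.

(** * Irreducible generators *)

Section Irreducible.
Context {R : realType} (p : nat) (G : 'M[R]_p) (pi : 'rV[R]_p).
Hypothesis G_gen : generator G.
Hypothesis G_irr : irreducible G.
Hypothesis pi_stat : stationary_distribution G pi.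
Let one : 'cV[R]_p := const_mx 1.

Let G_ge0 i j : i != j -> 0 <= G i j. Proof. by case: G_gen => + _; exact. Qed.

Lemma generator_one : G *m one = 0.
Proof.
case: G_gen => _ G0; apply/matrixP => i j; rewrite !mxE -[RHS](G0 i).
by apply: eq_bigr => k _; rewrite mxE mulr1.
Qed.

Lemma irreducible_ind (Pr : 'I_p -> Prop) j :
  (forall i k, i != k -> 0 < G i k -> Pr k -> Pr i) -> Pr j -> forall i, Pr i.
Proof.
move=> step Pj i; have /connectP[s] := G_irr i j.
elim: s i => [|k s IH] i /= => [_ <- //|/andP[/andP[ik Gik] ks] jE].
by apply: (step i k) => //; exact: IH.
Qed.

(** If [pi] vanishes at a state, the balance equation there makes it vanish at all predecessors,
    hence everywhere by irreducibility, against total mass 1. *)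
Lemma stationary_gt0 i : 0 < pi 0 i.
Proof.
have [pi0 pi1 piG] := pi_stat.
rewrite lt_def pi0 andbT; apply/negP => /eqP pii.
suff all0 : forall j, pi 0 j = 0.
  by move: pi1; rewrite big1 => [/esym/eqP|//]; rewrite oner_eq0.
apply: (@irreducible_ind (fun j => pi 0 j = 0) i) => // j k jk Gjk pik.
have /matrixP/(_ 0 k) := piG; rewrite !mxE (bigD1 k) //= pik mul0r add0r.
move=> /eqP; rewrite psumr_eq0 => [/allP/(_ j)|l lk]; last first.
  by rewrite mulr_ge0 // G_ge0.
rewrite mem_index_enum jk /= => /(_ isT).
by rewrite mulf_eq0 (gt_eqF Gjk) orbF => /eqP.
Qed.

Definition dirichlet (v : 'cV[R]_p) : R :=
  \sum_i \sum_j pi 0 i * G i j * (v i 0 - v j 0) ^+ 2.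

Lemma dirichlet_term_ge0 (v : 'cV[R]_p) i j : 0 <= pi 0 i * G i j * (v i 0 - v j 0) ^+ 2.
Proof.
have [->|ij] := eqVneq i j; first by rewrite subrr expr0n mulr0.
by rewrite mulr_ge0 ?sqr_ge0 // mulr_ge0 ?G_ge0 // ltW ?stationary_gt0.
Qed.

Lemma dirichlet_ge0 (v : 'cV[R]_p) : 0 <= dirichlet v.
Proof.
apply: sumr_ge0 => i _; apply: sumr_ge0 => j _; exact: dirichlet_term_ge0.
Qed.

(** Expanding the square, the terms in [v i ^ 2] cancel by the zero row sums and those in [v j ^ 2]
    by [pi G = 0]; only the cross terms remain. Reversibility does not enter. *)
Lemma dirichlet_generator (v : 'cV[R]_p) :
  2 * \sum_i pi 0 i * v i 0 * (G *m v) i 0 = - dirichlet v.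
Proof.
have [_ _ piG] := pi_stat.
have row0 : \sum_i \sum_j pi 0 i * G i j * v i 0 ^+ 2 = 0.
  rewrite big1 // => i _; rewrite -mulr_suml -mulr_sumr.
  by case: G_gen => _ ->; rewrite mulr0 mul0r.
have col0 : \sum_i \sum_j pi 0 i * G i j * v j 0 ^+ 2 = 0.
  rewrite exchange_big big1 // => j _; rewrite -mulr_suml.
  by have /matrixP/(_ 0 j) := piG; rewrite !mxE => ->; rewrite mul0r.
have E : 2 * (\sum_i pi 0 i * v i 0 * (G *m v) i 0) + dirichlet v =
    \sum_i \sum_j pi 0 i * G i j * v i 0 ^+ 2 +
    \sum_i \sum_j pi 0 i * G i j * v j 0 ^+ 2.
  rewrite /dirichlet mulr_sumr -!big_split; apply: eq_bigr => i _ /=.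
  rewrite mxE !mulr_sumr -!big_split; apply: eq_bigr => j _ /=.
  by ring.
by apply/eqP; rewrite -subr_eq0 opprK E row0 col0 addr0.
Qed.

(** Induction along a path: one edge is controlled by its own term of the Dirichlet form, and
    [(a + b)^2 <= 2 a^2 + 2 b^2] appends it. Summing the constants over all pairs makes [K]
    uniform. *)
Lemma poincare_pair : exists2 K : R, 0 < K &
  forall (v : 'cV[R]_p) i j, (v i 0 - v j 0) ^+ 2 <= K * dirichlet v.
Proof.
have pair i j : exists K : R, 0 <= K /\
    forall v : 'cV[R]_p, (v i 0 - v j 0) ^+ 2 <= K * dirichlet v.
  move: i; apply: (@irreducible_ind _ j) => [i k ik Gik [K [K0 Kv]]|]; last first.
    by exists 0; split => // v; rewrite subrr expr0n mul0r.
  have w0 : 0 < pi 0 i * G i k by rewrite mulr_gt0 // stationary_gt0.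
  exists (2 / (pi 0 i * G i k) + 2 * K); split.
    by apply: addr_ge0; [apply: ltW; exact: divr_gt0|exact: mulr_ge0].
  move=> v; have edge : (v i 0 - v k 0) ^+ 2 <= dirichlet v / (pi 0 i * G i k).
    rewrite ler_pdivlMr // mulrC /dirichlet (bigD1 i) //= (bigD1 k) //= -addrA lerDl.
    rewrite addr_ge0 ?sumr_ge0 // => [l _|l _]; first exact: dirichlet_term_ge0.
    by apply: sumr_ge0 => l' _; exact: dirichlet_term_ge0.
  have := Kv v; have := sqr_ge0 ((v i 0 - v k 0) - (v k 0 - v j 0)).
  have -> : (2 / (pi 0 i * G i k) + 2 * K) * dirichlet v =
      2 * (dirichlet v / (pi 0 i * G i k)) + 2 * (K * dirichlet v).
    by rewrite mulrDl -!mulrA (mulrC (dirichlet v)).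
  by move: edge; nra.
have [K KP] := choice (fun ij : 'I_p * 'I_p => pair ij.1 ij.2).
exists (1 + \sum_ij K ij) => [|v i j].
  by rewrite ltr_wpDr // sumr_ge0 // => ij _; have [] := KP ij.
have [_ /(_ v)/le_trans->//] := KP (i, j).
rewrite ler_wpM2r ?dirichlet_ge0 // (bigD1 (i, j)) //= addrCA lerDl addr_ge0 //.
by apply: sumr_ge0 => ij _; have [] := KP ij.
Qed.

(** For centred [v], averaging [(v i - v j)^2] over two independent copies of [pi] gives twice the
    variance, so the pairwise bound can be averaged. *)
Lemma poincare : exists2 K : R, 0 < K & forall v : 'cV[R]_p, pi *m v = 0 ->
  \sum_i pi 0 i * v i 0 ^+ 2 <= K * dirichlet v.
Proof.
have [K K0 Kv] := poincare_pair; exists K => // v piv.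
have [pi0 pi1 _] := pi_stat.
have {}piv : \sum_i pi 0 i * v i 0 = 0.
  by have /matrixP/(_ 0 0) := piv; rewrite !mxE.
have E : \sum_i \sum_j pi 0 i * pi 0 j * (v i 0 - v j 0) ^+ 2 =
    2 * \sum_i pi 0 i * v i 0 ^+ 2.
  transitivity (\sum_i \sum_j (pi 0 j * (pi 0 i * v i 0 ^+ 2) +
     (pi 0 i * (pi 0 j * v j 0 ^+ 2) - 2 * (pi 0 i * v i 0) * (pi 0 j * v j 0)))).
    by apply: eq_bigr => i _; apply: eq_bigr => j _; ring.
  under eq_bigr do
    rewrite big_split sumrB /= -mulr_suml -!mulr_sumr pi1 mul1r piv mulr0 subr0.
  by rewrite big_split /= -mulr_suml pi1; ring.
have : 2 * \sum_i pi 0 i * v i 0 ^+ 2 <= K * dirichlet v.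
  rewrite -E; apply: (@le_trans _ _ (\sum_i \sum_j pi 0 i * pi 0 j * (K * dirichlet v))).
    apply: ler_sum => i _; apply: ler_sum => j _.
    by rewrite ler_wpM2l ?mulr_ge0 ?pi0.
  under eq_bigr do rewrite -mulr_suml -mulr_sumr pi1 mulr1.
  by rewrite -mulr_suml pi1 mul1r.
have : 0 <= K * dirichlet v by rewrite mulr_ge0 ?dirichlet_ge0 // ltW.
lra.
Qed.

Lemma generator_kernel (v : 'cV[R]_p) i j : G *m v = 0 -> v i 0 = v j 0.
Proof.
move=> Gv; have [K K0 /(_ v i j)] := poincare_pair.
have -> : dirichlet v = 0.
  apply/eqP; rewrite -oppr_eq0 -dirichlet_generator Gv big1 ?mulr0 // => k _.
  by rewrite mxE mulr0.
by rewrite mulr0 => H; apply/eqP; rewrite -subr_eq0 -sqrf_eq0 eq_le H sqr_ge0.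
Qed.

Lemma dirichlet_gt0 (v : 'cV[R]_p) i j : v i 0 != v j 0 -> 0 < dirichlet v.
Proof.
move=> vij; have [K K0 /(_ v i j) H] := poincare_pair.
rewrite -(pmulr_rgt0 _ K0); apply: lt_le_trans H.
by rewrite lt_def sqr_ge0 sqrf_eq0 subr_eq0 vij.
Qed.

(** A right kernel vector [v] satisfies [pi v = 0] (multiply by [pi]), hence [G v = 0]; then [v] is
    constant and, being centred, zero. The transpose appears because [det0P] provides left kernel
    vectors. *)
Lemma generator_projection_unit : G + one *m pi \in unitmx.
Proof.
have [_ pi1 piG] := pi_stat.
rewrite -unitmx_tr unitmxE unitfE; apply/det0P => -[v v0].
move/(congr1 trmx); rewrite trmx_mul trmxK trmx0 mulmxDl => Mv.
have pione : pi *m one = 1%:M by exact: mul_one_total.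
have piv : pi *m v^T = 0.
  have := congr1 (mulmx pi) Mv; rewrite mulmx0 mulmxDr !mulmxA piG mul0mx add0r.
  by rewrite pione mul1mx.
move: Mv; rewrite -mulmxA piv mulmx0 addr0 => Gv.
case/eqP: v0; apply/matrixP => a i; rewrite ord1 mxE.
have vc j : v^T j 0 = v 0 i.
  by rewrite (generator_kernel j i Gv) mxE.
move/matrixP : piv => /(_ 0 0); rewrite !mxE.
by under eq_bigr do rewrite vc; rewrite -mulr_suml pi1 mul1r.
Qed.

Lemma stationary_unique (eta : 'rV[R]_p) : stationary_distribution G eta -> eta = pi.
Proof.
have mulM (mu : 'rV[R]_p) : stationary_distribution G mu ->
    mu *m (G + one *m pi) = pi.
  move=> [_ mu1 muG]; rewrite mulmxDr muG add0r mulmxA.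
  by rewrite (mul_one_total mu1) mul1mx.
move=> /mulM; rewrite -{2}(mulM pi pi_stat) => /(congr1 (mulmxr (invmx (G + one *m pi)))).
by rewrite /= -!mulmxA mulmxV ?generator_projection_unit // !mulmx1.
Qed.

Lemma poisson_equation (f : 'cV[R]_p) : pi *m f = 0 ->
  exists h, G *m h = - f /\ pi *m h = 0.
Proof.
have [_ pi1 piG] := pi_stat.
have pione : pi *m one = 1%:M by exact: mul_one_total.
move=> pif; have [h Mh] : exists h, G *m h + one *m (pi *m h) = - f.
  exists (invmx (G + one *m pi) *m (- f)).
  by rewrite (mulmxA one pi) -mulmxDl mulmxA mulmxV ?generator_projection_unit // mul1mx.
exists h.
have pih : pi *m h = 0.
  have := congr1 (mulmx pi) Mh; rewrite mulmxDr !mulmxA piG mul0mx add0r.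
  by rewrite pione mul1mx mulmxN pif oppr0.
by split => //; move: Mh; rewrite pih mulmx0 addr0.
Qed.
End Irreducible.

(** * The third-moment gap *)

Section Asymptotics.
Context {R : realType} (p : nat) (G : 'M[R]_p) (pi : 'rV[R]_p).
Hypothesis G_gen : generator G.
Hypothesis G_irr : irreducible G.
Hypothesis pi_stat : stationary_distribution G pi.

Definition weighted_norm (v : 'cV[R]_p) : R := \sum_i pi 0 i * v i 0 ^+ 2.

Lemma weighted_norm_ge0 v : 0 <= weighted_norm v.
Proof.
by case: pi_stat => pi0 _ _; apply: sumr_ge0 => i _; rewrite mulr_ge0 ?sqr_ge0.
Qed.

(** The rate t^(-3) for the squared norm is enough here and comes directly from monotonicity of
    [t^3 V(t)], without an exponential bound. *)
Lemma mexp_decay (v : 'cV[R]_p) (e : R) : pi *m v = 0 -> 0 < e ->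
  exists2 T : R, 1 <= T & forall t, T <= t ->
    t ^+ 2 * weighted_norm (mexp G 0 t *m v) <= e.
Proof.
move=> piv e0; have [_ _ piG] := pi_stat.
have [K K0 poin] := poincare G_gen G_irr pi_stat.
pose x t := mexp G 0 t *m v; pose V t := weighted_norm (x t).
have V0 t : 0 <= V t by exact: weighted_norm_ge0.
have pix t : pi *m x t = 0 by rewrite /x mulmxA (mexp_fix_left _ piG).
have dV t : derives V t (- dirichlet G pi (x t)).
  have dx : mderives x t (G *m x t).
    by rewrite /x mulmxA; exact: mderives_mulr (mderives_mexp_left G t).
  rewrite -(dirichlet_generator G_gen pi_stat) mulr_sumr.
  apply: derives_sum => i _; apply: derives_eq.
  - exact: (derivesMl (pi 0 i) (derivesM (dx i 0) (dx i 0))).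
  - by move=> s; rewrite expr2.
  - rewrite /x /=; ring.
have dt3 t : derives (fun s => s ^+ 3 * V s) t
    (3 * t ^+ 2 * V t - t ^+ 3 * dirichlet G pi (x t)).
  apply: derives_eq.
  - apply: (derivesM (f := fun s => s * (s * s)) _ (dV t)).
    exact: derivesM (derives_id t) (derivesM (derives_id t) (derives_id t)).
  - by move=> s; congr (_ * _); ring.
  - by rewrite /=; ring.
(* For s >= 3K, the Poincaré inequality gives [3 V <= 3 K dirichlet <= s dirichlet], so the
   derivative of [s^3 V] is nonpositive. *)
pose T0 := 3 * K; have T00 : 0 < T0 by rewrite mulr_gt0.
have mono t : T0 <= t -> t ^+ 3 * V t <= T0 ^+ 3 * V T0.
  move=> T0t; apply: (nonincr_of_derives T0t (fun s _ => dt3 s)) => [s|]; last first.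
    by apply: continuous_subspaceT => s; exact: (derives_continuous (dt3 s)).
  move=> /andP[T0s _]; have s0 : 0 < s by exact: lt_trans T0s.
  have := poin _ (pix s); rewrite -/(weighted_norm _) -/(V s) => VK.
  rewrite (_ : _ - _ = s ^+ 2 * (3 * V s - s * dirichlet G pi (x s))); last by ring.
  rewrite mulr_ge0_le0 ?sqr_ge0 // subr_le0.
  apply: (@le_trans _ _ (T0 * dirichlet G pi (x s))).
    by rewrite /T0 -mulrA ler_pM2l.
  by rewrite ler_wpM2r ?(ltW T0s) // dirichlet_ge0.
exists (1 + T0 + T0 ^+ 3 * V T0 / e) => [|t Tt].
  rewrite -addrA lerDl addr_ge0 ?(ltW T00) //.
  by rewrite divr_ge0 ?(ltW e0) // mulr_ge0 // exprn_ge0 // ltW.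
have C0 : 0 <= T0 ^+ 3 * V T0 / e.
  by rewrite divr_ge0 ?(ltW e0) // mulr_ge0 // exprn_ge0 // ltW.
have t1 : 0 < t by lra.
have /mono : T0 <= t by lra.
rewrite exprS -mulrA -/(x t) -/(V t) => H.
rewrite -(ler_pM2l t1) (le_trans H) // -ler_pdivrMr //; lra.
Qed.

Context (lam : 'rV[R]_p).
Let one : 'cV[R]_p := const_mx 1.
Let Lam := diag_mx lam.
Let lamc := Lam *m one.
Let u := pi *m Lam.

Let lamcE i : lamc i 0 = lam 0 i.
Proof. by rewrite /lamc /Lam mul_diag_mx !mxE mulr1. Qed.

Let uE (v : 'cV[R]_p) : (u *m v) 0 0 = \sum_i pi 0 i * lam 0 i * v i 0.
Proof. by rewrite mxE; apply: eq_bigr => i _; rewrite /u /Lam mul_mx_diag mxE. Qed.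

(* The difference of the third moments is six times this function. *)
Definition third_gap (t : R) : R :=
  ((t *: (u *m mexp G 1 t) - 2 *: (u *m mexp G 2 t)) *m lamc) 0 0.

Definition third_gap' (t : R) : R :=
  ((t *: (u *m mexp G 0 t) - u *m mexp G 1 t) *m lamc) 0 0.

Lemma derives_third_gap t : derives third_gap t (third_gap' t).
Proof.
have /(_ 0 0) := mderives_mulr lamc (mderivesB (mderivesZ (derives_id t)
  (mderives_mull u (mderives_mexpS G 0 t))) (mderivesZ (derives_cst 2 t)
  (mderives_mull u (mderives_mexpS G 1 t)))).
move/derives_eq; apply => //.
congr ((_ *m _) 0 0); rewrite scale1r scale0r add0r.
by apply/rowP => j; rewrite !mxE; ring.
Qed.

(** The derivative of order [k + 1] of g(t) = pi Lam exp(tG) Lam 1. *)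
Definition gap_derivative k (t : R) : R :=
  (u *m mexp G 0 t *m (G ^+ k *m (G *m lamc))) 0 0.

Lemma derives_third_gap' t : derives third_gap' t (t * gap_derivative 0 t).
Proof.
have /(_ 0 0) := mderives_mulr lamc (mderivesB (mderivesZ (derives_id t)
  (mderives_mull u (mderives_mexp G t))) (mderives_mull u (mderives_mexpS G 0 t))).
move/derives_eq; apply => //.
rewrite scale1r addrC addKr -scalemxAl mxE /gap_derivative expr0.
by rewrite -!mulmxA mul1mx.
Qed.

Lemma derives_gap_derivative k t :
  derives (gap_derivative k) t (gap_derivative k.+1 t).
Proof.
have /(_ 0 0) := mderives_mulr (G ^+ k *m (G *m lamc))
  (mderives_mull u (mderives_mexp G t)).
move/derives_eq; apply => //.
by rewrite /gap_derivative exprS -!mulmxA.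
Qed.

Hypothesis lam_nonconst : exists i j, lam 0 i != lam 0 j.

Lemma gap_derivative0_lt0 : (u *m (G *m lamc)) 0 0 < 0.
Proof.
have [i [j lij]] := lam_nonconst; rewrite uE.
have := dirichlet_generator G_gen pi_stat lamc.
have : 0 < dirichlet G pi lamc.
  by apply: (dirichlet_gt0 G_gen G_irr pi_stat (i := i) (j := j)); rewrite !lamcE.
under [in X in _ -> X -> _]eq_bigr do rewrite lamcE.
lra.
Qed.

(* With f the centred intensity and h solving G h = - f, the derivative of the
   gap is t u E f + u E h - u h, where E = exp(tG), and u h is half the
   Dirichlet form of h. *)
Lemma third_gap'_limit : exists T c : R,
  [/\ 0 < T, 0 < c & forall t, T <= t -> third_gap' t <= - c].
Proof.
have [pi0 pi1 piG] := pi_stat.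
have pione : pi *m one = 1%:M by exact: mul_one_total.
have Gone : G *m one = 0 by exact: generator_one.
pose m := (pi *m lamc) 0 0; pose f := lamc - m *: one.
have pif : pi *m f = 0.
  rewrite mulmxBr -scalemxAr pione; apply/matrixP => a b.
  by rewrite !ord1 !mxE eqxx mulr1 -/m /m !mxE subrr.
have [h [Gh pih]] := poisson_equation G_gen G_irr pi_stat pif.
have u1 : (u *m one) 0 0 = m by rewrite /u -mulmxA.
have uh : 0 < (u *m h) 0 0.
  have -> : (u *m h) 0 0 = \sum_i pi 0 i * f i 0 * h i 0.
    have pih0 : \sum_i pi 0 i * h i 0 = 0.
      by have /matrixP/(_ 0 0) := pih; rewrite !mxE.
    rewrite uE.
    transitivity (\sum_i pi 0 i * lam 0 i * h i 0 - m * \sum_i pi 0 i * h i 0).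
      by rewrite pih0 mulr0 subr0.
    rewrite mulr_sumr -sumrB.
    by apply: eq_bigr => i _; rewrite !mxE -lamcE !mxE; ring.
  have := dirichlet_generator G_gen pi_stat h; rewrite Gh.
  have -> : \sum_i pi 0 i * h i 0 * (- f) i 0 = - \sum_i pi 0 i * f i 0 * h i 0.
    by rewrite -sumrN; apply: eq_bigr => i _; rewrite mxE; ring.
  have : 0 < dirichlet G pi h; last lra.
  (* A zero Dirichlet form would make [h] constant, hence [f = - G h = 0] and all rates equal to
     their mean [m]. *)
  rewrite lt_def dirichlet_ge0 // andbT; apply/negP => /eqP h0.
  have hc i j : h i 0 = h j 0.
    apply/eqP/negPn/negP => hij.
    by have := dirichlet_gt0 G_gen G_irr pi_stat hij; rewrite h0 ltxx.
  have f0 : f = 0.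
    have [i [j lij]] := lam_nonconst.
    rewrite -[f]opprK -Gh (_ : h = h i 0 *: one).
      by rewrite -scalemxAr Gone scaler0 oppr0.
    by apply/matrixP => a b; rewrite !ord1 !mxE mulr1.
  have [i [j /eqP[]]] := lam_nonconst.
  have fz k : lam 0 k = m.
    have /matrixP/(_ k 0) := f0; rewrite !mxE -lamcE !mxE mulr1 => /eqP.
    by rewrite subr_eq0 => /eqP.
  by rewrite !fz.
have lE : lamc = m *: one + f by rewrite addrC subrK.
clearbody f.
have gapE t : third_gap' t = t * (u *m (mexp G 0 t *m f)) 0 0 +
    (u *m (mexp G 0 t *m h)) 0 0 - (u *m h) 0 0.
  have Jf : mexp G 1 t *m f = h - mexp G 0 t *m h.
    rewrite -[f]opprK -Gh mulmxN mulmxA mexp1_mul mulmxBl mul1mx opprB.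
    by [].
  have entry (a b : 'M[R]_1) s : (s *: a + b) 0 0 = s * a 0 0 + b 0 0 by rewrite !mxE.
  have El : mexp G 0 t *m lamc = m *: one + mexp G 0 t *m f.
    by rewrite {1}lE mulmxDr -scalemxAr (mexp_fix _ Gone).
  have Jl : mexp G 1 t *m lamc = (m * t) *: one + (h - mexp G 0 t *m h).
    by rewrite {1}lE mulmxDr -scalemxAr (mexp1_fix _ Gone) scalerA Jf.
  have -> : third_gap' t =
      t * (u *m (mexp G 0 t *m lamc)) 0 0 - (u *m (mexp G 1 t *m lamc)) 0 0.
    rewrite /third_gap' mulmxBl -scalemxAl entry (mulmxA u) (mulmxA u).
    by congr (_ + _); rewrite mxE.
  rewrite El Jl !mulmxDr mulmxN -!scalemxAr !entry u1.
  have entryB (a b : 'M[R]_1) : (a - b) 0 0 = a 0 0 - b 0 0 by rewrite !mxE.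
  by rewrite entryB; ring.
set k := (u *m h) 0 0 in uh gapE.
pose S := \sum_i pi 0 i * lam 0 i ^+ 2.
have S0 : 0 <= S by apply: sumr_ge0 => i _; rewrite mulr_ge0 ?sqr_ge0.
(* Each of the two decaying terms is split by the arithmetic-geometric inequality into parts of at
   most k/8, so together they use k/2 and leave [-k/2]. *)
pose e := k / (8 * (S + 1)).
have e0 : 0 < e by rewrite divr_gt0 // mulr_gt0 // ltr_wpDl.
have am_gm s (v : 'cV[R]_p) : s * (u *m v) 0 0 <=
    e * S + s ^+ 2 * weighted_norm v / (4 * e).
  rewrite uE /S /weighted_norm !mulr_sumr mulr_suml -big_split.
  apply: ler_sum => i _ /=; rewrite -subr_ge0.
  rewrite (_ : _ - _ = pi 0 i * (2 * e * lam 0 i - s * v i 0) ^+ 2 / (4 * e)).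
    apply: divr_ge0; last by apply: mulr_ge0 => //; exact: ltW.
    by apply: mulr_ge0; [exact: pi0|exact: sqr_ge0].
  by field; rewrite gt_eqF.
have ek : 0 < e * k / 2 by rewrite divr_gt0 // mulr_gt0.
have [T1 T11 T1P] := mexp_decay pif ek.
have [T2 T21 T2P] := mexp_decay pih ek.
exists (T1 + T2), (k / 2); split; [lra|lra|].
move=> t Tt; rewrite gapE.
have t1 : 1 <= t by lra.
have tT1 : T1 <= t by lra.
have tT2 : T2 <= t by lra.
have a1 := am_gm t (mexp G 0 t *m f); have a2 := am_gm 1 (mexp G 0 t *m h).
have e4 : 0 < 4 * e by apply: mulr_gt0.
have b1 : t ^+ 2 * weighted_norm (mexp G 0 t *m f) / (4 * e) <= k / 8.
  rewrite ler_pdivrMr //; apply: (le_trans (T1P t tT1)).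
  by rewrite le_eqVlt; apply/orP; left; apply/eqP; field.
have b2 : 1 ^+ 2 * weighted_norm (mexp G 0 t *m h) / (4 * e) <= k / 8.
  rewrite ler_pdivrMr //.
  apply: (@le_trans _ _ (t ^+ 2 * weighted_norm (mexp G 0 t *m h))).
    by rewrite ler_wpM2r ?weighted_norm_ge0 // expr1n exprn_ege1.
  apply: (le_trans (T2P t tT2)).
  by rewrite le_eqVlt; apply/orP; left; apply/eqP; field.
have eS : e * S <= k / 8.
  rewrite /e mulrAC ler_pdivrMr ?mulr_gt0 // ?ltr_wpDl //.
  rewrite (_ : k / 8 * (8 * (S + 1)) = k * (S + 1)); last by field.
  by rewrite ler_pM2l // lerDl.
by rewrite mul1r in a2; lra.
Qed.

Lemma third_gap_eventually_lt0 : exists T : R, forall t, T < t -> third_gap t < 0.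
Proof.
have [T [c [T0 c0 Tc]]] := third_gap'_limit.
exists (T + `|third_gap T| / c) => t Tt.
have Tt' : T <= t.
  by rewrite ltW // (le_lt_trans _ Tt) // lerDl divr_ge0 // ltW.
have H : third_gap t + c * t <= third_gap T + c * T.
  apply: (nonincr_of_derives (f := fun s => third_gap s + c * s)
    (d := fun s => third_gap' s + c * 1) Tt') => [s _|s /andP[Ts _]|].
  - by apply: derivesD; [exact: derives_third_gap|exact: derivesMl (derives_id s)].
  - by rewrite mulr1 -lerBrDr sub0r; apply: Tc; exact: ltW.
  - apply: continuous_subspaceT => s.
    apply: derives_continuous.
    exact: derivesD (derives_third_gap s) (derivesMl c (derives_id s)).
have : `|third_gap T| < c * (t - T) by rewrite mulrC -ltr_pdivrMr // ltrBrDl.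
by have := ler_norm (third_gap T); lra.
Qed.
End Asymptotics.

(** * Accumulation points of zeros *)

Definition zeros_cluster {R : realType} (f : R -> R) (tau : R) :=
  forall e, 0 < e -> exists z, [/\ z != tau, `|z - tau| < e & f z = 0].

Lemma zeros_cluster_eq0 {R : realType} (f f' : R -> R) (tau : R) :
  (forall t, derives f t (f' t)) -> zeros_cluster f tau -> f tau = 0.
Proof.
move=> df acc; apply/eqP/negPn/negP => ftau.
have /cvgrPdist_lt := derives_continuous (df tau).
move=> /(_ `|f tau|); rewrite normr_gt0 => /(_ ftau) [e /= e0 eP].
have [z [_ zt fz]] := acc e e0.
by have := eP z; rewrite /= distrC fz subr0 ltxx => /(_ zt).
Qed.

(** By continuity [f] vanishes at [tau] too, so Rolle's theorem puts a zero of [f'] strictly between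
    [tau] and each nearby zero of [f]. *)
Lemma zeros_cluster_derive {R : realType} (f f' : R -> R) (tau : R) :
  (forall t, derives f t (f' t)) -> zeros_cluster f tau ->
  zeros_cluster f' tau.
Proof.
move=> df acc e e0; have ftau := zeros_cluster_eq0 df acc.
have cf a b : {within `[a, b], continuous f}.
  by apply: continuous_subspaceT => s; exact: (derives_continuous (df s)).
have [z [ztau ze fz]] := acc e e0.
have rolle a b : a < b -> f a = f b -> exists2 c, a < c < b & f' c = 0.
  move=> ab fab.
  have [|c cab dc] := Rolle ab _ (cf a b) fab.
    by move=> x _; have [] := df x.
  exists c; first by move: cab; rewrite in_itv.
  have := df c; rewrite /derives => dfc.
  by rewrite -(@derive_val _ _ _ _ _ _ _ dfc) (@derive_val _ _ _ _ _ _ _ dc).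
move: ze; rewrite ltr_norml => /andP[z1 z2].
case: (ltgtP z tau) ztau => // [zt _|tz _].
  have [|c /andP[c1 c2] fc] := rolle z tau zt; first by rewrite fz ftau.
  by exists c; split; rewrite ?lt_eqF // ltr_norml; apply/andP; split; lra.
have [|c /andP[c1 c2] fc] := rolle tau z tz; first by rewrite fz ftau.
by exists c; split; rewrite ?gt_eqF // ltr_norml; apply/andP; split; lra.
Qed.

Lemma zeros_cluster_exists {R : realType} (f : R -> R) (T : R) :
  infinite_set [set t | 0 <= t <= T /\ f t = 0] -> exists tau, zeros_cluster f tau.
Proof.
move=> inf; have [|tau tauP] := infinite_bounded_limit_point_nonempty inf.
  exists T; split; first exact: num_real.
  move=> x Tx y /= [/andP[y0 yT] _].
  by rewrite ger0_norm // (le_trans yT) // ltW.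
exists tau => e e0; have [z [zt [_ fz] ze]] := tauP _ (nbhsx_ballx tau e e0).
by exists z; split => //; rewrite distrC.
Qed.

Lemma mexp_bilinear {R : realType} p (G : 'M[R]_p) (a : 'rV[R]_p) (c : 'cV[R]_p) s :
  (a *m mexp G 0 s *m c) 0 0 = egf (fun k => (a *m G ^+ k *m c) 0 0) s.
Proof.
have expand (M : 'M[R]_p) : (a *m M *m c) 0 0 =
    \sum_(ij : 'I_p * 'I_p) a 0 ij.1 * c ij.2 0 * M ij.1 ij.2.
  rewrite mxE; under eq_bigr do rewrite mxE mulr_suml.
  rewrite exchange_big pair_big; apply: eq_bigr => ij _ /=.
  by rewrite mulrAC.
rewrite expand; under [in RHS]eq_fun do rewrite expand.
rewrite (egf_lin _ (fun ij : 'I_p * 'I_p => a 0 ij.1 * c ij.2 0) _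
  (fun ij => geometric_growth_mx G ij.1 ij.2)).
by apply: eq_bigr => ij _; rewrite mxE.
Qed.

Lemma egf_eq0 {R : realType} (c : nat -> R) s : (forall k, c k = 0) -> egf c s = 0.
Proof.
move=> c0; rewrite /egf; apply: cvg_lim => //.
rewrite (_ : pseries _ s = cst 0); first exact: cvg_cst.
by apply/funext => n; rewrite /pseries /series /= big1 // => k _; rewrite c0 !mul0r.
Qed.

(** Eventual negativity confines the zeros to [0, T]. Infinitely many would accumulate at some
    [tau], and Rolle carries the accumulation to every derivative; the identity theorem thus becomes
    a Taylor expansion at [tau]. *)
Lemma third_gap_zeros {R : realType} p (G : 'M[R]_p) (pi lam : 'rV[R]_p) :
  generator G -> irreducible G -> stationary_distribution G pi ->
  (exists i j, lam 0 i != lam 0 j) ->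
  exists2 E : set R, finite_set E &
    forall t, 0 < t -> ~ E t -> third_gap G pi lam t <> 0.
Proof.
move=> G_gen G_irr pi_stat nonc.
have [T neg] := third_gap_eventually_lt0 G_gen G_irr pi_stat nonc.
exists [set t | 0 <= t <= T /\ third_gap G pi lam t = 0]; last first.
  move=> t t0 nE gt; apply: nE; split => //=; rewrite (ltW t0) leNgt.
  by apply/negP => /neg; rewrite gt ltxx.
apply: contrapT => /zeros_cluster_exists[tau acc].
have := gap_derivative0_lt0 G_gen G_irr pi_stat nonc.
have acc1 := zeros_cluster_derive (derives_third_gap G pi lam) acc.
have acc2 := zeros_cluster_derive (derives_third_gap' G pi lam) acc1.
(* The factor t must be divided out of [t g'(t)]. Its zero at 0 is excluded by [z != tau] if
   [tau = 0], and by [|z - tau| < |tau|] otherwise. *)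
have acc3 : zeros_cluster (gap_derivative G pi lam 0) tau.
  move=> e e0; have [tau0|tau0] := eqVneq tau 0.
    have [z [zt ze /eqP]] := acc2 e e0.
    by rewrite mulf_eq0 -{1}tau0 (negbTE zt) /= => /eqP gz; exists z.
  have [|z [zt ze /eqP]] := acc2 (Num.min e `|tau|).
    by rewrite lt_min e0 normr_gt0.
  move: ze; rewrite lt_min => /andP[ze zt0]; rewrite mulf_eq0 => /orP[/eqP z0|/eqP gz].
    by move: zt0; rewrite z0 sub0r normrN ltxx.
  by exists z.
have acck k : zeros_cluster (gap_derivative G pi lam k) tau.
  elim: k => // k IH.
  exact: zeros_cluster_derive (derives_gap_derivative G pi lam k) IH.
have gk k : gap_derivative G pi lam k tau = 0.
  exact: zeros_cluster_eq0 (derives_gap_derivative G pi lam k) (acck k).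
have inv : mexp G 0 tau *m mexp G 0 (- tau) = 1%:M.
  by have := mexpNK G (- tau); rewrite opprK.
(* Taylor expansion of g' about [tau] with increment [- tau]: its coefficients are the
   [gap_derivative k tau], all zero, so g'(0) = 0, against its negativity. *)
set lamc := diag_mx lam *m const_mx 1 in gk *; set u := pi *m diag_mx lam.
have -> : (u *m (G *m lamc)) 0 0 =
    (u *m mexp G 0 tau *m mexp G 0 (- tau) *m (G *m lamc)) 0 0.
  by rewrite -(mulmxA u) inv mulmx1.
rewrite mexp_bilinear egf_eq0 ?ltxx // => k.
by rewrite -(gk k) /gap_derivative -/lamc -/u -!mulmxA.
Qed.

Theorem theorem3p4 (R : realType) (p : nat) (G : 'M[R]_p) (lam : 'rV[R]_p)
    (d1 : measure_display) (T1 : measurableType d1) (P1 : probability T1 R)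
    (N1 : R -> T1 -> nat) (X1 : R -> T1 -> 'I_p)
    (d2 : measure_display) (T2 : measurableType d2) (P2 : probability T2 R)
    (N2 : R -> T2 -> nat) (X2 : R -> T2 -> 'I_(\sum_(i < p) 2)) :
  (2 <= p)%N ->
  generator G ->
  irreducible G ->
  slow G lam ->
  time_stationary_MAP P1 (MMPP_C G lam) (MMPP_D lam) N1 X1 ->
  time_stationary_MAP P2 (MTCP_C G lam) (MTCP_D G lam) N2 X2 ->
  (forall t : R, 0 <= t ->
     moment P1 N1 1 t = moment P2 N2 1 t /\
     moment P1 N1 2 t = moment P2 N2 2 t) /\
  ((exists i j, lam 0 i != lam 0 j) ->
     exists2 E : set R, finite_set E &
       forall t : R, 0 < t -> ~ E t -> moment P1 N1 3 t <> moment P2 N2 3 t).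
Proof.
move=> _ G_gen G_irr slowG [pi pi_stat1 map1] [eta eta_stat map2].
have pi_stat : stationary_distribution G pi by move: pi_stat1; rewrite /MMPP_C subrK.
have [pi0 pi1 piG] := pi_stat.
have lam0 i : 0 <= lam 0 i.
  by case: map1 => -[D0 _ _ _ _] _ _ _; have := D0 i i; rewrite mxE eqxx mulr1n.
(* The lumped stationary law is stationary for [G], so by uniqueness both forward systems start from
   the same vector [pi]. *)
have etaK : eta *m @block_sum R p = pi.
  apply: (stationary_unique G_gen G_irr pi_stat).
  by apply: (block_sum_stationary (lam := lam) G_gen); rewrite -MTCP_generator.
have [A [fA PA]] := MAP_forward pi0 map1.
have eta0 i : 0 <= eta 0 i by case: eta_stat.
have [B' [fB' PB']] := MAP_forward eta0 map2.
pose B n t := B' n t *m (@block_sum R p).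
have fB : forward_system (- diag_mx lam) (G + diag_mx lam) pi B.
  rewrite -etaK; apply: forward_system_mulr fB'.
  - by move=> s j; rewrite block_sumE.
  - exact: MTCP_C_block_sum.
  - exact: MTCP_D_block_sum.
have PB n t : 0 <= t -> measurable [set w | N2 t w = n] /\
    P2 [set w | N2 t w = n] = (\sum_j B n t 0 j)%:E.
  move=> t0; have [mN ->] := PB' n t t0; split => //.
  by rewrite sum_mul_one -block_sum_one mulmxA -sum_mul_one.
have G1 : G *m const_mx 1 = 0 :> 'cV[R]_p by exact: generator_one.
have Lam0 i : 0 <= (diag_mx lam *m const_mx 1 : 'cV[R]_p) i 0.
  by rewrite mul_diag_mx !mxE mulr1.
have gap t : 0 <= t -> exists lA lB : nat -> R,
    [/\ [/\ moment P1 N1 1 t = (lA 1%N)%:E,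
            moment P1 N1 2 t = (2 * lA 2%N + lA 1%N)%:E
          & moment P1 N1 3 t = (6 * lA 3%N + 6 * lA 2%N + lA 1%N)%:E],
        [/\ moment P2 N2 1 t = (lB 1%N)%:E,
            moment P2 N2 2 t = (2 * lB 2%N + lB 1%N)%:E
          & moment P2 N2 3 t = (6 * lB 3%N + 6 * lB 2%N + lB 1%N)%:E]
      & [/\ lB 1%N - lA 1%N = 0, lB 2%N - lA 2%N = 0
          & lB 3%N - lA 3%N = third_gap G pi lam t]].
  move=> t0.
  have QA : (MMPP_C G lam + MMPP_D lam) *m const_mx 1 = 0 :> 'cV[R]_p.
    by rewrite /MMPP_C subrK.
  have QB : (- diag_mx lam + (G + diag_mx lam)) *m const_mx 1 = 0 :> 'cV[R]_p.
    by rewrite addrC addrK.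
  have LB i : 0 <= ((G + diag_mx lam) *m const_mx 1 : 'cV[R]_p) i 0.
    by rewrite mulmxDl G1 add0r.
  have [lA [cA mA1 mA2 mA3]] := forward_moments fA QA Lam0 pi1 t0 (fun n => PA n t t0).
  have [lB [cB mB1 mB2 mB3]] := forward_moments fB QB LB pi1 t0 (fun n => PB n t t0).
  have gapE k l : (fun M => \sum_j binomial_moment B k M t 0 j -
      \sum_j binomial_moment A k M t 0 j) @ \oo --> l -> lB k - lA k = l.
    move=> cl; apply: (@cvg_unique _ _ _ _ _ _ _ cl) => //.
    by apply: cvgB; [exact: cB|exact: cA].
  exists lA, lB; split=> //; split; apply: gapE;
    exact: (total_binomial_gap fA fB G1 Lam0 pi1 piG t0).
split=> [t t0|nonc].
  have [lA [lB [[-> -> _] [-> -> _] [e1 e2 _]]]] := gap t t0.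
  by rewrite (subr0_eq e1) (subr0_eq e2).
have [E finE gapE] := third_gap_zeros G_gen G_irr pi_stat nonc.
exists E => // t t0 tE.
have [lA [lB [[_ _ ->] [_ _ ->] [e1 e2 e3]]]] := gap t (ltW t0).
move=> [] eq3; apply: (gapE t t0 tE); rewrite -e3.
have := subr0_eq e1; have := subr0_eq e2; lra.
Qed.
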